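(* The functions $\gamma$ and $\Gamma$ satisfy: (a) $\frac{3}{4} \le \liminf\limits_{k \to \infty} \frac{\gamma(k)}{k} \le \frac{9}{10}$; (b) $\limsup\limits_{k \to \infty} \frac{\gamma(k)}{k} = \frac{3}{2}$; (c) $\frac{1}{2} \le \liminf\limits_{k \to \infty} \frac{\Gamma(k)-\gamma(k)}{k} \le \frac{3}{4}$; (d) $\frac{11}{6} \le \limsup\limits_{k \to \infty} \frac{\Gamma(k)-\gamma(k)}{k} \le \frac{9}{4}$.
   Context: The Thue-Morse word is the infinite binary word $\mathbf{t}=t_0t_1t_2\cdots$ over $\{0,1\}$ which is the limit of the words $A_n$, where $A_0=0$ and $A_n=A_{n-1}\overline{A_{n-1}}$ for $n\ge 1$, the bar denoting the exchange $0\leftrightarrow 1$ in every letter; equivalently, $t_n\in\{0,1\}$ is the sum of the base-2 digits of $n$ reduced modulo 2. A word $W$ of length $kn$ is a $k$-antipower if $W=w_1\cdots w_k$ with $|w_i|=n$ for all $i$ and $w_i\ne w_j$ for all $i\neq j$. For a positive integer $k$, let $\mathcal{F}(k)$ be the set of odd positive integers $n$ such that the prefix of $\mathbf{t}$ of length $kn$ (its first $kn$ letters) is a $k$-antipower. It is known that $\mathcal{F}(k)$ is nonempty and that only finitely many odd positive integers are not in $\mathcal{F}(k)$. Define $\gamma(k)=\min\mathcal{F}(k)$, and define $\Gamma(k)$ to be the largest odd positive integer not in $\mathcal{F}(k)$, with $\Gamma(k)=0$ if $\mathcal{F}(k)$ contains all odd positive integers. Limits are over positive integers $k\to\infty$.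 *)

(* Defs.v *)
From mathcomp Require Import all_boot all_order all_algebra.
From mathcomp Require Import all_classical all_reals all_analysis.

Set Implicit Arguments.
Unset Strict Implicit.
Unset Printing Implicit Defensive.

Local Open Scope classical_set_scope.

(* Letters are booleans: [false] stands for 0 and [true] for 1. *)
Fixpoint tm_word (m : nat) : seq bool :=
  if m is m'.+1 then tm_word m' ++ map negb (tm_word m') else [:: false].

(* The limit of the words [tm_word m]: the word [tm_word n] has 2 ^ n > n
   letters, and each [tm_word m] is a prefix of the next one.  That every
   [tm_word m] is a prefix of the limit is [tm_prefix_pow2] below. *)
Definition thue_morse (n : nat) : bool := nth false (tm_word n) n.

Definition tm_prefix (l : nat) : seq bool := mkseq thue_morse l.

Definition antipower (T : eqType) (k : nat) (w : seq T) : Prop :=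
  exists (n : nat) (ws : seq (seq T)),
    [/\ size ws = k, {in ws, forall u, size u = n}, uniq ws & w = flatten ws].

Definition AP (k : nat) : set nat :=
  [set n | odd n /\ antipower k (tm_prefix (k * n))].

Definition coAP (k : nat) : set nat := [set n | odd n /\ ~ AP k n].

(* An element of a set that is a lower (upper) bound of it is its minimum
   (maximum).  The default value 0 of [gamma k] would only be used if [AP k]
   were empty, which never happens for k > 0; the default value 0 of [Gamma k]
   is the convention for the case where [coAP k], always finite for k > 0,
   is empty. *)
Definition gamma (k : nat) : nat := xget 0 (AP k `&` lbound (AP k)).

Definition Gamma (k : nat) : nat := xget 0 (coAP k `&` ubound (coAP k)).

Lemma size_tm_word m : size (tm_word m) = 2 ^ m.
Proof. by elim: m => //= m IH; rewrite size_cat size_map IH expnS mul2n addnn. Qed.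

Lemma nth_tm_word m p i : m <= p -> i < 2 ^ m ->
  nth false (tm_word p) i = nth false (tm_word m) i.
Proof.
move=> /subnKC <-; elim: (p - m) => [|d IH] im; first by rewrite addn0.
rewrite addnS /= nth_cat size_tm_word IH //.
by rewrite (leq_trans im) // leq_exp2l // leq_addr.
Qed.

Lemma tm_prefix_pow2 m : tm_prefix (2 ^ m) = tm_word m.
Proof.
apply: (@eq_from_nth _ false); rewrite size_mkseq ?size_tm_word // => i im.
rewrite nth_mkseq // /thue_morse; have [mi|/ltnW mi] := leqP m i.
  exact: nth_tm_word.
by rewrite [RHS](@nth_tm_word i) // ltn_expl.
Qed.

(* Main.v *)
Require Import Defs.
From mathcomp Require Import all_boot all_order all_algebra.
From mathcomp Require Import all_classical all_reals all_analysis.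
From mathcomp Require Import zify lra.

(** Let [K(m)] be the least number [k] such that two of the first [k] blocks of
    length [m] of the Thue-Morse word [t] coincide ([repeats m k]).  An odd [m]
    belongs to [AP k] exactly when [k < K(m)], so [gamma k] is the least odd [m]
    with [K(m) > k], and [Gamma k] is the greatest odd [m] with [K(m) <= k].  The
    theorem thus compares [K(m)] with [m].

    Reduction to letters.  Choose [D = 2 ^ d] with [3 D < 2 m <= 6 D].  A factor
    of [t] longer than [3 D / 2] determines its position modulo [D]
    ([agree_sync]), so that two equal blocks have indices [i] and [i + s D]; in
    particular [K(m) > D >= m / 3].  As [t] is obtained from itself by replacing
    each letter by a word of length [D] or by its complement, block [i], which
    starts at [i m = q D + r], is determined by [r] and by the at most four
    letters from position [q] on, and blocks [i] and [i + s D] are equal exactly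
    when these letters occur again at distance [s m] ([blocks_to_letters],
    [letters_to_blocks]).

    Upper bounds on [K].  Let [w] be the even one of [(m - 1) / 2] and
    [(m + 1) / 2].  Suppose that [t p = t (p + 1)] and that both letters are
    complemented at distance [w] ([twin w p]).  Then six letters at about [4 p]
    recur at distance [2 m], and six letters contain the four that a block needs
    for each of three consecutive values of [q]; as [m < 3 D], some [i] of order
    at most [p] takes one of these values, and [K(m) <= 2 D + O(p)].  Twins come
    from the largest power [2 ^ h] that divides [w] up to a bounded error: there
    is one at about [2 ^ h] or twice that.  If [2 ^ h] is negligible with respect
    to [D], this settles the matter.  Otherwise [m] is very close to an odd
    multiple [Z] of [2 ^ (h + 1)]; then three letters that recur at distance [m]
    itself are enough, provided that [i m] modulo [D] is small, which a linear
    congruence modulo [Z] achieves ([align_single]).  Hence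
    [K(m) <= (2 + o(1)) D] when [m < 3 D - 13] ([repeats_by_two_eps]), and
    [K(m) <= 4 D] whenever [D >= 64] ([repeats_by_four]).

    Lower bounds on [K] hold for special lengths, by inspection of the letters:
    [K(3 2 ^ n + 1) >= (5 / 3) 2 ^ (n + 1) - O(1)], [K(2 ^ n + 3) > 2 ^ n + 1],
    and [K(2 ^ n - 3) > 2 ^ n + 6] for even [n].  Conversely, for suitable fixed
    [i] some [m] of size [(3 - 1 / (i + 1)) D - O(1)] has [K(m) <= D + i + 1]
    ([repeats_near_triple]).

    Conclusion.  The upper bounds on [K] give [gamma k >= (3 / 4 - o(1)) k], and
    they give [gamma k >= (3 / 2 - o(1)) k] for [k] slightly larger than a power
    of two.  The first two special lengths give [gamma k <= (3 / 2) k + O(1)],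
    and [gamma k <= (9 / 10) k + O(1)] at [k] about [(5 / 3) 2 ^ n].  Next,
    [Gamma k < 3 k] for positive [k], and [Gamma k <= (3 / 2) k] when [k > 1] is
    a power of two; this yields the upper bounds on the difference.  Its lower
    bounds are obtained by comparing, for each position of [k] between two powers
    of two, the special lengths with those of [repeats_near_triple]; the value
    [11 / 6] comes from [k = 2 ^ n + 6] with [n] even, where
    [gamma k <= 2 ^ n - 3] and [Gamma k >= (17 / 6) 2 ^ n - O(1)]. *)

Set Implicit Arguments.
Unset Strict Implicit.
Unset Printing Implicit Defensive.

Local Notation t := thue_morse.

(** * Letters of the Thue-Morse word *)

Lemma tm_add_pow2 m i : i < 2 ^ m -> t (2 ^ m + i) = ~~ t i.
Proof.
move=> im; have le : m.+1 <= 2 ^ m + i by rewrite (leq_trans (ltn_expl m (ltnSn 1))) ?leq_addr.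
have lt : 2 ^ m + i < 2 ^ m.+1 by rewrite expnS mul2n -addnn ltn_add2l.
rewrite {1}/thue_morse (nth_tm_word le lt) /= nth_cat size_tm_word ltnNge.
rewrite leq_addr /= addKn (nth_map false) ?size_tm_word //; congr (~~ _).
have [mi|/ltnW mi] := leqP m i; first by rewrite -(nth_tm_word mi).
by rewrite /thue_morse (nth_tm_word mi) // ltn_expl.
Qed.

Lemma top_bit n : 0 < n -> exists2 m, 2 ^ m <= n & n < 2 ^ m + 2 ^ m.
Proof.
move=> n0; exists (trunc_log 2 n); first exact: trunc_logP.
by rewrite addnn -mul2n -expnS trunc_log_ltn.
Qed.

Lemma tm_even_odd n : t (2 * n) = t n /\ t (2 * n).+1 = ~~ t n.
Proof.
elim/ltn_ind: n => -[|n] IH //.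
have [m lo hi] := top_bit (ltn0Sn n).
have [IH0 IH1] : t (2 * (n.+1 - 2 ^ m)) = t (n.+1 - 2 ^ m) /\
    t (2 * (n.+1 - 2 ^ m)).+1 = ~~ t (n.+1 - 2 ^ m).
  by apply: IH; have := expn_gt0 2 m; lia.
have e : n.+1 = 2 ^ m + (n.+1 - 2 ^ m) by lia.
have tn : t n.+1 = ~~ t (n.+1 - 2 ^ m) by rewrite {1}e tm_add_pow2; lia.
have e2 : 2 * n.+1 = 2 ^ m.+1 + 2 * (n.+1 - 2 ^ m) by rewrite expnS; lia.
rewrite e2 -addnS !tm_add_pow2 ?IH0 ?IH1 ?tn // expnS; lia.
Qed.

Lemma tm2 n : t (2 * n) = t n. Proof. by case: (tm_even_odd n). Qed.
Lemma tm2S n : t (2 * n).+1 = ~~ t n. Proof. by case: (tm_even_odd n). Qed.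

(** Self-similarity: the sum of binary digits is additive when the digits of [z]
    lie below those of [Q * 2 ^ d]. *)
Lemma tm_block d Q z : z < 2 ^ d -> t (Q * 2 ^ d + z) = t Q (+) t z.
Proof.
elim: d Q z => [|d IH] Q z zd.
  by move: zd; rewrite expn0 ltnS leqn0 => /eqP ->; rewrite muln1 addn0 addbF.
have z2 : z./2 < 2 ^ d by move: zd; rewrite expnS; lia.
have -> : Q * 2 ^ d.+1 + z = odd z + 2 * (Q * 2 ^ d + z./2).
  by rewrite expnS mulnDr mul2n; lia.
have tz : t z = odd z (+) t z./2.
  rewrite -{1}(odd_double_half z) -mul2n.
  by case: (odd z); rewrite ?add1n ?add0n ?tm2 ?tm2S.
by rewrite tz; case: (odd z); rewrite ?add1n ?add0n ?tm2 ?tm2S IH //;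
  case: (t Q); case: (t _).
Qed.

Lemma tm4 n : [/\ t (4 * n) = t n, t (4 * n + 1) = ~~ t n,
  t (4 * n + 2) = ~~ t n & t (4 * n + 3) = t n].
Proof.
have E j : j < 4 -> t (4 * n + j) = t n (+) t j.
  by move=> j4; rewrite mulnC (@tm_block 2).
have [t0 t1 t2 t3] : [/\ t 0 = false, t 1 = true, t 2 = true & t 3 = false].
  by split.
split; last 1 first.
- by rewrite (E 3) // t3 addbF.
- by rewrite -[4 * n]addn0 (E 0) // t0 addbF.
- by rewrite (E 1) // t1 addbT.
- by rewrite (E 2) // t2 addbT.
Qed.

(** The letters at positions [2 n] and [2 n + 1] differ, so equal neighbours
    straddle two such pairs and the next letter is forced. *)
Lemma tm_cube a : t a = t a.+1 -> t a.+2 = ~~ t a.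
Proof.
rewrite -(odd_double_half a) -mul2n; case: (odd a); rewrite ?add1n ?add0n.
  have e : (2 * a./2).+2 = 2 * a./2.+1 by lia.
  by rewrite e !tm2 !tm2S => <-; case: (t _).
by rewrite tm2 tm2S; case: (t _).
Qed.

Lemma tm_eqS_odd a : t a = t a.+1 -> odd a.
Proof.
rewrite -{1 2}(odd_double_half a) -mul2n; case: (odd a) => //.
by rewrite add0n tm2 tm2S; case: (t _).
Qed.

(** There is no cube of a letter. *)
Lemma tm_recur a (v : bool) : exists2 b, a <= b <= a + 2 & t b = v.
Proof.
have H := @tm_cube a.
have [e|ne] := eqVneq (t a) v; first by exists a; [lia|].
have [e1|ne1] := eqVneq (t a.+1) v; first by exists a.+1; [lia|].
exists a.+2; first lia.
by move: ne ne1 H; case: (t a); case: (t a.+1); case: v => // _ _ ->.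
Qed.

(** * Synchronization of equal blocks *)

Definition agree a b l := forall x, x < l -> t (a + x) = t (b + x).
Definition equal_blocks m i j := agree (i * m) (j * m) m.
Definition repeats m k := exists i j, [/\ i < j, j < k & equal_blocks m i j].

Lemma repeats_mono m k k' : k <= k' -> repeats m k -> repeats m k'.
Proof. by move=> kk [i [j [ij jk e]]]; exists i, j; split=> //; lia. Qed.

Lemma agree_parity a b l : 4 <= l -> agree a b l -> odd a = odd b.
Proof.
wlog ob : a b / odd b => [hw|] l4 H.
  case ob : (odd b); first by rewrite (hw a b).
  case oa : (odd a) => //; rewrite -ob -oa; apply/esym/hw => // x xl.
  by rewrite H.
case oa : (odd a); first by rewrite ob.
exfalso; have ea' : a = 2 * a./2 by lia.
have eb' : b = (2 * b./2).+1 by lia.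
have := H 0; have := H 1; have := H 2; have := H 3.
set u := a./2 in ea'; set v := b./2 in eb'.
have -> : a + 0 = 2 * u by lia.
have -> : a + 1 = (2 * u).+1 by lia.
have -> : a + 2 = 2 * u.+1 by lia.
have -> : a + 3 = (2 * u.+1).+1 by lia.
have -> : b + 0 = (2 * v).+1 by lia.
have -> : b + 1 = 2 * v.+1 by lia.
have -> : b + 2 = (2 * v.+1).+1 by lia.
have -> : b + 3 = 2 * v.+2 by lia.
rewrite !tm2S !tm2.
move=> /(_ l4) h3 /(_ (ltnW l4)) h2 /(_ (ltnW (ltnW l4))) h1.
move=> /(_ (ltnW (ltnW (ltnW l4)))) h0; have := @tm_cube v; move: h0 h1 h2 h3.
by case: (t u); case: (t u.+1); case: (t v); case: (t v.+1); case: (t v.+2)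
  => //= _ _ _ _ /(_ erefl).
Qed.

Lemma agree_half a b l : odd a = odd b -> agree a b l ->
  agree a./2 b./2 (uphalf l).
Proof.
move=> op H x xl.
have E c : odd c = odd a ->
    t (c + (2 * x - odd a)) = t (c./2 + x) (+) (odd a && (x == 0)).
  move=> oc; have [oa|oa] := boolP (odd a).
    have [x0|x0] := eqVneq x 0.
      have -> : c + (2 * x - true) = (2 * (c./2 + x)).+1.
        by rewrite x0; move: oc; rewrite oa; lia.
      by rewrite tm2S addbT.
    have -> : c + (2 * x - true) = 2 * (c./2 + x) by move: oc; rewrite oa; lia.
    by rewrite tm2 addbF.
  have -> : c + (2 * x - false) = 2 * (c./2 + x).
    by move: oc; rewrite (negbTE oa); lia.
  by rewrite tm2 addbF.
apply: (@addIb (odd a && (x == 0))); rewrite -!E ?op //.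
by apply: H; move: xl; rewrite uphalf_half; lia.
Qed.

(** Parity is determined by four letters.  Halving both positions turns a factor
    of length [l] into one of length [uphalf l], and the hypothesis for [d.+1]
    and [l] becomes the one for [d] and [uphalf l]. *)
Lemma agree_sync d a b l : 3 * 2 ^ d < 2 * l -> agree a b l -> a = b %[mod 2 ^ d].
Proof.
elim: d a b l => [|d IH] a b l; first by rewrite !modn1.
rewrite expnS => dl H.
have op : odd a = odd b.
  by apply: (@agree_parity _ _ l) H; have := expn_gt0 2 d; lia.
have /IH/(_ (agree_half op H)) e : 3 * 2 ^ d < 2 * uphalf l.
  by rewrite uphalf_half; lia.
rewrite -(odd_double_half a) -(odd_double_half b) -!mul2n op.
by apply/eqP; rewrite eqn_modDl -!muln_modr e.
Qed.

(** [m] is odd, hence invertible modulo [2 ^ d]. *)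
Lemma equal_blocks_mod d m i j : odd m -> 3 * 2 ^ d < 2 * m -> equal_blocks m i j ->
  i = j %[mod 2 ^ d].
Proof.
move=> om dm /(agree_sync dm)/eqP.
have co : coprime (2 ^ d) m by rewrite coprimeXl ?coprime2n.
wlog ij : i j / i <= j => [hw|].
  have /orP[/hw//|/hw {}hw] := leq_total i j.
  by rewrite eq_sym => /hw ->.
by rewrite eq_sym !eqn_mod_dvd ?leq_mul2r ?ij ?orbT // -mulnBl Gauss_dvdl //
  -eqn_mod_dvd // eq_sym => /eqP.
Qed.

Lemma equal_blocks_step d m i j : odd m -> 3 * 2 ^ d < 2 * m -> i < j -> equal_blocks m i j ->
  exists2 s, 0 < s & j = i + s * 2 ^ d.
Proof.
move=> om dm ij /(equal_blocks_mod om dm)/eqP.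
rewrite eq_sym eqn_mod_dvd ?(ltnW ij) // => /dvdnP[s js].
by exists s; [case: s js|]; lia.
Qed.

(** Block [i] lies in the images of the letters [q + u] with
    [u * 2 ^ d < r + m], and [s * 2 ^ d] more blocks shift these letters by
    [s * m].  The remainder [r] may exceed [2 ^ d] here, which leaves freedom in
    the choice of [q]. *)
Lemma letters_to_blocks d m i s q r : i * m = q * 2 ^ d + r ->
  (forall u, u * 2 ^ d < r + m -> t (q + u) = t (q + u + s * m)) ->
  equal_blocks m i (i + s * 2 ^ d).
Proof.
move=> im H x xm; have D0 := expn_gt0 2 d.
have e := divn_eq (r + x) (2 ^ d).
have lt : (r + x) %% 2 ^ d < 2 ^ d by rewrite ltn_mod D0.
set u := _ %/ _ in e; set z := _ %% _ in e lt.
have -> : i * m + x = (q + u) * 2 ^ d + z by rewrite im mulnDl; lia.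
have -> : (i + s * 2 ^ d) * m + x = (q + u + s * m) * 2 ^ d + z.
  by rewrite mulnDl im mulnAC; lia.
by rewrite !tm_block // H //; lia.
Qed.

(** The image of each letter [q + u] meets the block, and a single letter of
    that image determines [t (q + u)]. *)
Lemma blocks_to_letters d m i s q r u : equal_blocks m i (i + s * 2 ^ d) ->
  i * m = q * 2 ^ d + r -> r < 2 ^ d -> u * 2 ^ d < r + m ->
  t (q + u) = t (q + u + s * m).
Proof.
move=> E im rD ur.
pose x := u * 2 ^ d - r.
have xm : x < m by rewrite /x; lia.
have [z zD ez] : exists2 z, z < 2 ^ d & r + x = u * 2 ^ d + z.
  have [ru|ru] := leqP r (u * 2 ^ d); first by exists 0; rewrite /x ?expn_gt0; lia.
  by exists (r - u * 2 ^ d); rewrite /x; lia.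
have := E x xm.
have -> : i * m + x = (q + u) * 2 ^ d + z by rewrite im mulnDl; lia.
have -> : (i + s * 2 ^ d) * m + x = (q + u + s * m) * 2 ^ d + z.
  by rewrite mulnDl im mulnAC; lia.
by rewrite !tm_block //; apply: addIb.
Qed.

Local Opaque thue_morse.

(** * Twins: the source of repetitions *)

(* Equations between letters are Boolean and would make [lia] split on them. *)
Ltac nlia := repeat match goal with H : context [thue_morse] |- _ => clear H end; lia.
(** A doubled letter that is complemented at distance [w]: the pattern whose
    images under the Thue-Morse substitution recur at distances close to [2 w]
    and [4 w]. *)
Definition twin w p :=
  [/\ t p = t p.+1, t (p + w) = t (p + w).+1 & t (p + w) = ~~ t p].

Lemma tm4S n : t (4 * n + 4) = t n.+1 /\ t (4 * n + 5) = ~~ t n.+1.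
Proof.
have [h0 h1 _ _] := tm4 n.+1; split; first by rewrite -h0; congr t; nlia.
by rewrite -h1; congr t; nlia.
Qed.

(** Six letters at [4 x] (for [m = 2 w + 1]) or [4 x + 2] (for [m = 2 w - 1]):
    the Boolean [b] selects the sign.  The images of [t x = t (x + 1)] are
    [a ~a ~a a a ~a ~a a], whose complement is, up to its ends, the same word
    shifted by two; the complementation at distance [w] compensates the
    difference between [2 m] and [4 w]. *)
Lemma twin_six w x m (b : bool) v : twin w x -> m + 2 * b = 2 * w + 1 ->
  v < 6 -> t (4 * x + 2 * b + v) = t (4 * x + 2 * b + v + 2 * m).
Proof.
move=> [e1 e2 ne] mw v6.
have [a0 a1 a2 a3] := tm4 x; have [a4 a5] := tm4S x.
have [_ _ a6 a7] := tm4 x.+1.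
have [c0 c1 c2 c3] := tm4 (x + w); have [c4 c5] := tm4S (x + w).
have [_ _ c6 c7] := tm4 (x + w).+1.
case: b mw => mw.
  have -> : 4 * x + 2 * true + v + 2 * m = 4 * (x + w) + v by nlia.
  case: v v6 => [|[|[|[|[|[|v]]]]]] // _.
  - by rewrite !addn0 c0 a2 ne.
  - by rewrite -[4 * x + _ + _]addnA a3 c1 ne negbK.
  - by rewrite -[4 * x + _ + _]addnA a4 c2 ne -e1 negbK.
  - by rewrite -[4 * x + _ + _]addnA a5 c3 ne -e1.
  - rewrite c4 -e2 ne e1 -a6; congr t; nlia.
  - rewrite c5 -e2 ne e1 negbK -a7; congr t; nlia.
have -> : 4 * x + 2 * false + v = 4 * x + v by nlia.
case: v v6 => [|[|[|[|[|[|v]]]]]] // _.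
- rewrite addn0 a0 -[t x]negbK -ne -c2; congr t; nlia.
- rewrite a1 -ne -c3; congr t; nlia.
- rewrite a2 -ne e2 -c4; congr t; nlia.
- rewrite a3 -[t x]negbK -ne e2 -c5; congr t; nlia.
- rewrite a4 -e1 -[t x]negbK -ne e2 -c6; congr t; nlia.
- rewrite a5 -e1 -ne e2 -c7; congr t; nlia.
Qed.

(** The same compensation at half the scale: [a ~a a ~a] is complemented by a
    shift by one, and [m] differs from [2 w] by one. *)
Lemma twin_three w p m (b : bool) v : twin w p -> m + 2 * b = 2 * w + 1 ->
  v < 3 -> t (2 * p + b + v) = t (2 * p + b + v + m).
Proof.
move=> [e1 e2 ne] mw v3.
case: b mw => mw; case: v v3 => [|[|[|v]]] // _.
- have -> : 2 * p + true + 0 = (2 * p).+1 by nlia.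
  have -> : (2 * p).+1 + m = 2 * (p + w) by nlia.
  by rewrite tm2S tm2 ne.
- have -> : 2 * p + true + 1 = 2 * p.+1 by nlia.
  have -> : 2 * p.+1 + m = (2 * (p + w)).+1 by nlia.
  by rewrite tm2S tm2 ne negbK.
- have -> : 2 * p + true + 2 = (2 * p.+1).+1 by nlia.
  have -> : (2 * p.+1).+1 + m = 2 * (p + w).+1 by nlia.
  by rewrite tm2S tm2 -e1 -e2 ne.
- have -> : 2 * p + false + 0 = 2 * p by nlia.
  have -> : 2 * p + m = (2 * (p + w)).+1 by nlia.
  by rewrite tm2S tm2 ne negbK.
- have -> : 2 * p + false + 1 = (2 * p).+1 by nlia.
  have -> : (2 * p).+1 + m = 2 * (p + w).+1 by nlia.
  by rewrite tm2S tm2 -e2 ne.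
- have -> : 2 * p + false + 2 = 2 * p.+1 by nlia.
  have -> : 2 * p.+1 + m = (2 * (p + w).+1).+1 by nlia.
  by rewrite tm2S tm2 -e1 -e2 ne negbK.
Qed.

(** At most four letters matter, because [m < 3 * 2 ^ d].  The six letters at
    [4 x + 2 b] therefore serve for three consecutive values of the starting
    letter, and multiples of [m] cannot jump over an interval of length
    [3 * 2 ^ d]. *)
Lemma twin_blocks_double d w x m (b : bool) : twin w x -> m + 2 * b = 2 * w + 1 ->
  0 < m < 3 * 2 ^ d ->
  exists2 i, i * m < (4 * x + 5) * 2 ^ d & equal_blocks m i (i + 2 * 2 ^ d).
Proof.
move=> T mw /andP[m0 m3]; set D := 2 ^ d; set Q := 4 * x + 2 * b.
have D0 : 0 < D by rewrite expn_gt0.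
(* the first block that starts in the image of letter [Q] or later *)
pose i := (Q * D + m.-1) %/ m.
have [lo hi] : Q * D <= i * m /\ i * m < Q * D + m.
  have := divn_eq (Q * D + m.-1) m; have := ltn_pmod (Q * D + m.-1) m0.
  by rewrite -/i; nlia.
exists i; first by move: hi; rewrite /Q !mulnDl; case: (b); nlia.
have im := divn_eq (i * m) D; have rD := ltn_pmod (i * m) D0.
apply: (letters_to_blocks im) => u ur.
set q := _ %/ _ in im *; set r := _ %% _ in im ur rD.
have Qq : Q <= q.
  by rewrite leqNgt; apply/negP => qQ; have := leq_mul2r D q.+1 Q; rewrite qQ orbT mulSn; nlia.
have qu : q + u < Q + 6.
  rewrite ltnNge; apply/negP => h; have := leq_mul2r D (Q + 6) (q + u).
  by rewrite h orbT !mulnDl; nlia.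
have -> : q + u = Q + (q + u - Q) by nlia.
by apply: twin_six T mw _; nlia.
Qed.

Lemma twin_blocks_single d w p m (b : bool) i r : twin w p -> m + 2 * b = 2 * w + 1 ->
  i * m = (2 * p + b) * 2 ^ d + r -> r + m <= 3 * 2 ^ d ->
  equal_blocks m i (i + 2 ^ d).
Proof.
move=> T mw im rm; rewrite -[2 ^ d]mul1n; apply: (letters_to_blocks im) => u ur.
rewrite mul1n; apply: twin_three T mw _.
rewrite -(ltn_pmul2r (expn_gt0 2 d)); nlia.
Qed.

(** [Z + 1] and [Z + 2] are [2 n] and [2 n + 1] for some [n], whereas
    [t 1 = t 2]. *)
Lemma tm_dyadic Z : odd Z -> forall v, exists2 X, 0 < X <= 2 & t (Z + X) (+) t X = v.
Proof.
move=> oZ v; have := tm2 Z./2.+1; have := tm2S Z./2.+1.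
have -> : (2 * Z./2.+1).+1 = Z + 2 by nlia.
have -> : 2 * Z./2.+1 = Z + 1 by nlia.
have [t1 t2] : t 1 = true /\ t 2 = true by split; vm_compute.
move=> h2 h1; have [e|ne] := eqVneq (t (Z + 1) (+) t 1) v; first by exists 1.
exists 2 => //; move: ne; rewrite h2 h1 t1 t2; case: (t _); case: v => //.
Qed.

(** Each pair [(p0, p1)] consists of two positions of doubled letters.  The
    differences [p1 - p0] are [0], [2], [-2], [6] and [-6], which represent all
    even residues modulo 16 that are not multiples of 4, together with 0. *)
Definition seeds := [:: (1, 1); (5, 7); (7, 5); (1, 7); (7, 1)].

Lemma seedP p0 p1 : (p0, p1) \in seeds ->
  [/\ p0 <= 7, p1 <= 7, t p0 = t p0.+1 & t p1 = t p1.+1].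
Proof.
by rewrite !inE => /or4P[|||/orP[]] /eqP[-> ->]; split; vm_compute.
Qed.

(** A multiple of 4 is used as it is; otherwise [w] is moved to a multiple of 16
    by [2] or [6]. *)
Lemma even_dyadic w : ~~ odd w -> 10 < w -> exists Z h p0 p1,
  [/\ odd Z, w + p0 = Z * 2 ^ h + p1, (p0, p1) \in seeds &
      p0.+1 < 2 ^ h /\ p1.+1 < 2 ^ h].
Proof.
move=> ew w10.
have dy n k : 0 < n -> 2 ^ k %| n ->
    exists Z h, [/\ odd Z, n = Z * 2 ^ h & 2 ^ k <= 2 ^ h].
  move=> n0 /dvdnP[c nc]; have c0 : 0 < c by case: c nc; nlia.
  have [Z oZ e] := pfactor_coprime (isT : prime 2) c0.
  exists Z, (logn 2 c + k); split; last by rewrite leq_exp2l // leq_addl.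
    by move: oZ; rewrite coprime2n.
  by rewrite nc {1}e expnD mulnA.
have := divn_eq w 16; set c := w %/ 16; set r := w %% 16 => wr.
have r16 : r < 16 by rewrite ltn_mod.
have [d4|d4] := boolP (4 %| w).
  have [Z [h [oZ e hh]]] := dy w 2 ltac:(nlia) d4.
  by exists Z, h, 1, 1; split=> //; nlia.
have [r2|r2] := boolP ((r == 2) || (r == 6)).
  have c0 : 0 < c by nlia.
  have [Z [h [oZ e hh]]] := dy (c * 16) 4 ltac:(nlia) (dvdn_mull _ (dvdnn _)).
  case/orP: r2 => /eqP r2.
    by exists Z, h, 5, 7; split=> //; nlia.
  by exists Z, h, 1, 7; split=> //; nlia.
have [Z [h [oZ e hh]]] := dy (c.+1 * 16) 4 ltac:(nlia) (dvdn_mull _ (dvdnn _)).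
have [r3|r3] := eqVneq r 14.
  by exists Z, h, 7, 5; split=> //; nlia.
have r10 : r = 10 by nlia.
by exists Z, h, 7, 1; split=> //; nlia.
Qed.

(** Doubled letters at [p0] and [p1] stay doubled after a translation by
    multiples of 16 and of [2 ^ h]; the choice of [X] only adjusts whether the
    two pairs are complementary. *)
Lemma seed_twin w Z h p0 p1 X u : w + p0 = Z * 2 ^ h + p1 ->
  (p0, p1) \in seeds -> p0.+1 < 2 ^ h -> p1.+1 < 2 ^ h ->
  (u = 0 \/ 16 * u + 16 <= 2 ^ h) ->
  t (Z + X) (+) t X = ~~ (t p0 (+) t p1) -> twin w (X * 2 ^ h + (16 * u + p0)).
Proof.
move=> we /seedP[p07 p17 e0 e1] h0 h1 uh zx.
have lt p : p <= 8 -> p < 2 ^ h -> 16 * u + p < 2 ^ h.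
  by move=> p8 ph; case: uh => [->|]; nlia.
have tu p : p < 16 -> t (16 * u + p) = t u (+) t p.
  by move=> p16; rewrite mulnC (@tm_block 4).
have T Y p : p <= 8 -> p < 2 ^ h ->
    t (Y * 2 ^ h + (16 * u + p)) = t Y (+) (t u (+) t p).
  by move=> p8 ph; rewrite tm_block ?lt // tu //; nlia.
have -> : twin w (X * 2 ^ h + (16 * u + p0)) <->
   [/\ t (X * 2 ^ h + (16 * u + p0)) = t (X * 2 ^ h + (16 * u + p0.+1)),
      t ((Z + X) * 2 ^ h + (16 * u + p1)) = t ((Z + X) * 2 ^ h + (16 * u + p1.+1)) &
      t ((Z + X) * 2 ^ h + (16 * u + p1)) = ~~ t (X * 2 ^ h + (16 * u + p0))].
  rewrite /twin.
  have -> : X * 2 ^ h + (16 * u + p0) + w = (Z + X) * 2 ^ h + (16 * u + p1).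
    by rewrite mulnDl; nlia.
  by rewrite -!addnS.
rewrite !T //; try nlia.
rewrite -e0 -e1; split=> //; move: zx.
by case: (t _); case: (t X); case: (t u); case: (t p0); case: (t p1).
Qed.

(** * Aligning a block with a twin at distance m *)

Lemma linear_congruence Z a B : 0 < Z -> 0 < a -> coprime a Z ->
  exists2 u, u < Z & Z %| B + a * u.
Proof.
move=> Z0 a0 co; pose n := chinese Z a 0 B + B * (Z * a).
have co' : coprime Z a by rewrite coprime_sym.
have nZ : Z %| n.
  have e := chinese_modl co' 0 B; rewrite mod0n in e.
  by rewrite dvdn_addr; [rewrite mulnCA dvdn_mulr|rewrite /dvdn e].
have nB : B <= n by have := leq_pmulr B (n := Z * a); rewrite muln_gt0 Z0 a0 /n; lia.
have na : a %| n - B.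
  rewrite -eqn_mod_dvd //; apply/eqP.
  by rewrite /n addnC mulnA modnMDl chinese_modr.
have [u0 e] := dvdnP na.
exists (u0 %% Z); first by rewrite ltn_mod.
rewrite -(dvdn_addr _ (m := a * (u0 %/ Z * Z))).
  have -> : a * (u0 %/ Z * Z) + (B + a * (u0 %% Z)) = B + a * (u0 %/ Z * Z + u0 %% Z) by lia.
  by rewrite -divn_eq mulnC -e subnKC.
by rewrite mulnA dvdn_mull.
Qed.

Lemma round_quotient A Z (s : bool) : 0 < Z -> exists rho kap,
  rho * Z = A + kap /\ (if s then kap < Z else 0 < kap <= Z).
Proof.
move=> Z0; have e := divn_eq A Z; have lt := ltn_pmod A Z0.
case: s; last first.
  by exists (A %/ Z).+1, (Z - A %% Z); split; [rewrite mulSn|]; lia.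
have [r0|r0] := posnP (A %% Z); first by exists (A %/ Z), 0; split; lia.
by exists (A %/ Z).+1, (Z - A %% Z); split; [rewrite mulSn|]; lia.
Qed.

(** Here [m = Z * H + c] with [c = c1 - c0], and [D = g * H]. A block that
    starts at [q * D + r] with [q = X * H + q1 + 32 * u.+1] and [r + m <= 3 * D]
    is sought. The index is taken of the form [i * Z = X * g * H + (q1 + 32 * u)
    * g + rho], where [u] makes the right-hand side divisible by [Z]; the
    resulting remainder satisfies [Z * r = kap * H + c * E] with [E = (q1 + 32 *
    u) * g + rho] of order [g * g], and [rho] is the rounded quotient that puts
    [kap] between [0] and [Z], away from [Z] when [c > 0] and from [0] when [c <
    0]. As [H] exceeds the error term, [0 <= r] and [r + c <= H], and [Z + 1 <=
    3 * g] gives the bound. *)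
Lemma align_single Z g H X q1 m c0 c1 : coprime 2 Z -> (exists e, g = 2 ^ e) ->
  3 <= Z -> Z < 3 * g -> 1600 * (g * g) <= H -> 0 < X <= 2 -> q1 <= 15 ->
  m + c0 = Z * H + c1 -> c0 <= 16 -> c1 <= 15 -> c1 <= c0 + 13 -> c0 <= c1 + 13 ->
  exists i u, [/\ u < Z, i <= g * H,
    (X * H + q1 + 32 * u.+1) * (g * H) <= i * m &
    i * m + m <= (X * H + q1 + 32 * u.+1 + 3) * (g * H)].
Proof.
move=> oZ [e ge] Z3 Zg Hg /andP[X0 X2] q15 mc c016 c115 c13 c31.
have g0 : 0 < g by rewrite ge expn_gt0.
have Z0 : 0 < Z by lia.
pose s := c0 <= c1.
have xg : X * g <= 2 * g by nia.
(* [rho] should round [- c * X * g / Z]; the summand [32 * g] keeps it a natural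
   number and accounts for the successor in [32 * u.+1]. *)
have [A eA] : exists A, A + c1 * (X * g) = 32 * g * Z + c0 * (X * g).
  by exists (32 * g * Z + c0 * (X * g) - c1 * (X * g)); nia.
have [rho [kap [er kb]]] := round_quotient A s Z0.
have cop : coprime (32 * g) Z.
  by rewrite ge -[32]/(2 ^ 5) -expnD coprimeXl.
have [u uZ /dvdnP[i ei]] := linear_congruence (X * g * H + q1 * g + rho) Z0
  (ltac:(lia) : 0 < 32 * g) cop.
exists i, u.
pose E := (q1 + 32 * u) * g + rho.
have kZ : kap <= Z by move: kb; case: (s); lia.
have rb : rho <= 42 * g.
  have : rho * Z <= 42 * g * Z.
    have : c0 * (X * g) <= c1 * (X * g) + 13 * (2 * g).
      rewrite (leq_trans (leq_mul c31 (leqnn _))) // mulnDl leq_add2l.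
      by rewrite leq_mul2l.
    have : g * 3 <= g * Z by rewrite leq_mul2l Z3 orbT.
    have : Z <= g * Z by rewrite leq_pmull.
    by lia.
  by rewrite leq_pmul2r.
have EB : E <= 32 * (Z * g) + 25 * g.
  have : u.+1 * g <= Z * g by rewrite leq_mul2r uZ orbT.
  have : q1 * g <= 15 * g by rewrite leq_mul2r q15 orbT.
  by rewrite /E mulSn; lia.
have hi : i * Z = X * g * H + E by rewrite -ei /E; lia.
(* [Z * r = kap * H + c * E], written without subtraction *)
have key : Z * (i * m) + c0 * E =
    Z * ((X * H + q1 + 32 * u.+1) * (g * H)) + kap * H + c1 * E.
  have h1 : (X * g * H + E) * (m + c0) = (X * g * H + E) * (Z * H + c1) by rewrite mc.
  have h2 : (rho * Z + c1 * (X * g)) * H = (32 * g * Z + c0 * (X * g) + kap) * H.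
    by congr (_ * _); lia.
  have h3 : i * Z * m = (X * g * H + E) * m by rewrite hi.
  by move: h1 h2 h3; clear; rewrite /E; lia.
have cE : 13 * (E + Z) <= H.
  have : Z.+1 * g <= 3 * g * g by rewrite leq_mul2r Zg orbT.
  by rewrite mulSn; lia.
split=> //.
- suff : i * Z <= g * H * Z by rewrite leq_pmul2r.
  rewrite hi; have : X * g * H <= 2 * g * H by rewrite !leq_mul.
  have : g * H * 3 <= g * H * Z by rewrite leq_mul2l Z3 orbT.
  have : H <= g * H by rewrite leq_pmull.
  by lia.
- suff : Z * ((X * H + q1 + 32 * u.+1) * (g * H)) <= Z * (i * m) by rewrite leq_pmul2l.
  have : c0 * E <= kap * H + c1 * E; last lia.
  move: kb; rewrite /s; have [c01|c10] := leqP c0 c1.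
    by move=> _; rewrite (leq_trans (leq_mul c01 (leqnn E))) ?leq_addl.
  move=> /andP[k0 _]; have : (c0 - c1) * E <= 13 * E by rewrite leq_mul2r; lia.
  rewrite mulnBl; have : H <= kap * H by rewrite leq_pmull.
  by lia.
- suff : Z * (i * m + m) <= Z * ((X * H + q1 + 32 * u.+1 + 3) * (g * H)).
    by rewrite leq_pmul2l.
  rewrite !mulnDr (mulnDl _ 3) mulnDr.
  suff : kap * H + c1 * E + Z * m <= 3 * Z * (g * H) + c0 * E by lia.
  have Zm : Z * m + Z * c0 = Z * Z * H + Z * c1 by rewrite -mulnDr mc; lia.
  have Zf : Z * Z * H + Z * H <= 3 * Z * (g * H).
    have : (Z.+1) * (Z * H) <= 3 * g * (Z * H) by rewrite leq_mul2r Zg orbT.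
    by lia.
  suff : kap * H + c1 * (E + Z) <= Z * H + c0 * (E + Z) by rewrite !mulnDr; lia.
  move: kb; rewrite /s; have [c01|c10] := leqP c0 c1.
    move=> kZ'; have : (c1 - c0) * (E + Z) <= 13 * (E + Z) by rewrite leq_mul2r; lia.
    rewrite mulnBl; have : kap.+1 * H <= Z * H by rewrite leq_mul2r kZ' orbT.
    by rewrite mulSn; lia.
  by move=> _; rewrite leq_add // leq_mul // ltnW.
Qed.

(** * Upper bounds on the first repetition *)

Lemma twin_repeats_double d w x m (b : bool) e k : twin w x -> m + 2 * b = 2 * w + 1 ->
  0 < m < 3 * 2 ^ d -> (4 * x + 5) * 2 ^ d <= e * m -> 2 * 2 ^ d + e <= k ->
  repeats m k.
Proof.
move=> T mw m3 xe ek; have [i im E] := twin_blocks_double T mw m3.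
exists i, (i + 2 * 2 ^ d); split=> //; first by have := expn_gt0 2 d; lia.
suff : i < e by lia.
by rewrite -(ltn_pmul2r (_ : 0 < m)); lia.
Qed.

Lemma twin_repeats_single d w p m (b : bool) i k : twin w p -> m + 2 * b = 2 * w + 1 ->
  (2 * p + b) * 2 ^ d <= i * m -> i * m + m <= (2 * p + b + 3) * 2 ^ d ->
  i + 2 ^ d < k -> repeats m k.
Proof.
move=> T mw lo hi ik; exists i, (i + 2 ^ d); split=> //.
  by have := expn_gt0 2 d; lia.
apply: (@twin_blocks_single _ _ _ _ _ _ (i * m - (2 * p + b) * 2 ^ d) T mw).
  by rewrite subnKC.
by move: hi; rewrite mulnDl; lia.
Qed.

(** The even one of [(m - 1) / 2] and [(m + 1) / 2], split into an odd multiple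
    of a power of two and the difference of a seed. *)
Definition decomposition m Z h p0 p1 (b : bool) :=
  [/\ odd Z, (p0, p1) \in seeds, p0.+1 < 2 ^ h /\ p1.+1 < 2 ^ h &
    exists w, m + 2 * b = 2 * w + 1 /\ w + p0 = Z * 2 ^ h + p1].

Lemma odd_decomposition m : odd m -> 24 < m ->
  exists Z h p0 p1 b, decomposition m Z h p0 p1 b.
Proof.
move=> om m24; pose b := odd m./2.
have [Z [h [p0 [p1 [oZ e sd lt]]]]] : exists Z h p0 p1,
   [/\ odd Z, m./2 + b + p0 = Z * 2 ^ h + p1, (p0, p1) \in seeds &
      p0.+1 < 2 ^ h /\ p1.+1 < 2 ^ h].
  by apply: even_dyadic; rewrite /b; lia.
exists Z, h, p0, p1, b; split=> //; exists (m./2 + b); split=> //.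
by rewrite /b; lia.
Qed.

Lemma decomposition_twin m Z h p0 p1 b : decomposition m Z h p0 p1 b ->
  exists w X, [/\ m + 2 * b = 2 * w + 1, w + p0 = Z * 2 ^ h + p1, 0 < X <= 2 &
   forall u, u = 0 \/ 16 * u + 16 <= 2 ^ h -> twin w (X * 2 ^ h + (16 * u + p0))].
Proof.
move=> [oZ sd [lt0 lt1] [w [mw we]]].
have [X X2 tX] := tm_dyadic oZ (~~ (t p0 (+) t p1)).
by exists w, X; split=> // u hu; apply: (seed_twin we sd lt0 lt1 hu tX).
Qed.

(** The twin has [p <= 2 * 2 ^ h + 7]: useful when [2 ^ h] is small with respect
    to [2 ^ d]. *)
Lemma repeats_double d m Z h p0 p1 b e k : decomposition m Z h p0 p1 b ->
  0 < m < 3 * 2 ^ d -> (4 * 2 ^ h.+1 + 33) * 2 ^ d <= e * m ->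
  2 * 2 ^ d + e <= k -> repeats m k.
Proof.
move=> dec m3 em; have [p07 _ _ _] : [/\ p0 <= 7, p1 <= 7, t p0 = t p0.+1 & t p1 = t p1.+1].
  by case: dec => _ /seedP.
have [w [X [mw _ /andP[_ X2] T]]] := decomposition_twin dec.
apply: (twin_repeats_double (T 0 (or_introl erefl)) mw m3); apply: leq_trans em.
rewrite leq_mul2r; apply/orP; right.
have : X * 2 ^ h <= 2 * 2 ^ h by rewrite leq_mul2r X2 orbT.
by rewrite expnS; nlia.
Qed.

(** The complementary case: when [2 ^ h.+1] dominates [4 ^ e], a repetition at
    distance one scale exists before block [2 * 2 ^ d].  The translations of the
    twin by multiples of 16 provide the progression of step 32 that
    [align_single] solves in. *)
Lemma repeats_single e m Z h p0 p1 b k : decomposition m Z h p0 p1 b ->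
  3 <= Z -> Z < 3 * 2 ^ e -> 1600 * (2 ^ e * 2 ^ e) <= 2 ^ h.+1 ->
  2 * (2 ^ e * 2 ^ h.+1) < k -> repeats m k.
Proof.
move=> dec Z3 Zg Hg hk.
have [p07 p17 pc] : [/\ p0 <= 7, p1 <= 7 & p0 <= p1 + 6 /\ p1 <= p0 + 6].
  by case: dec => _ + _ _; rewrite !inE => /or4P[|||/orP[]] /eqP[-> ->].
have oZ : odd Z by case: dec.
have [w [X [mw we Xb T]]] := decomposition_twin dec.
have [i [u [uZ iD lo hi]]] : exists i u, [/\ u < Z, i <= 2 ^ e * 2 ^ h.+1,
    (X * 2 ^ h.+1 + (2 * p0 + b) + 32 * u.+1) * (2 ^ e * 2 ^ h.+1) <= i * m &
    i * m + m <= (X * 2 ^ h.+1 + (2 * p0 + b) + 32 * u.+1 + 3) * (2 ^ e * 2 ^ h.+1)].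
  apply: (@align_single _ _ _ _ _ _ (2 * p0 + 2 * b) (2 * p1 + 1)) => //; try lia.
  - by rewrite coprime2n.
  - by exists e.
  - by rewrite expnS; lia.
have hu : 16 * u.+1 + 16 <= 2 ^ h.
  have : 2 ^ e <= 2 ^ e * 2 ^ e by rewrite leq_pmull ?expn_gt0.
  by move: Hg; rewrite expnS; nlia.
have q2 : 2 * (X * 2 ^ h + (16 * u.+1 + p0)) + b =
    X * 2 ^ h.+1 + (2 * p0 + b) + 32 * u.+1 by rewrite expnS; nlia.
apply: (@twin_repeats_single (e + h.+1) _ _ _ _ i _ (T u.+1 (or_intror hu)) mw);
  rewrite ?q2 expnD //.
by nlia.
Qed.

(** Here [m = 2 * 2 ^ d + c] with [c] in [{-13, ..., 13}]. As [2 ^ d] is half of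
    [2 ^ h.+1], the parameter [g] of [align_single] would be 1/2, so the
    repetition must be found otherwise. If the two letters of the seed agree,
    the seed itself is a twin because [t 0 <> t 1]. The remaining [c] are [3],
    [5], [-3] and [-5]; the repeated blocks are given explicitly. *)
Lemma repeats_near_pow2 d m h p0 p1 b k : decomposition m 1 h p0 p1 b -> 64 <= 2 ^ d ->
  3 * 2 ^ d < 2 * m -> m < 3 * 2 ^ d -> 2 * 2 ^ d + 22 <= k -> repeats m k.
Proof.
move=> [_ sd [lt0 lt1] [w [mw we]]] D64 m3 m6 hk.
have [p07 p17 _ _] := seedP sd.
have hd : h = d.
  have : 2 ^ h.+1 < 2 ^ d.+2 by rewrite !expnS; nlia.
  have : 2 ^ d < 2 ^ h.+1 by rewrite !expnS; nlia.
  by rewrite !ltn_exp2l //; nlia.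
move: we lt0 lt1; rewrite hd => we lt0 lt1.
have t01 : t 0 = false /\ t 1 = true by split; vm_compute.
have [tau|ntau] := eqVneq (t p0 (+) t p1) false.
  have T : twin w (0 * 2 ^ d + (16 * 0 + p0)).
    apply: (seed_twin we sd lt0 lt1 (or_introl erefl)).
    by case: t01 => -> ->; rewrite tau.
  have pD : p0 * 2 ^ d <= 7 * 2 ^ d by rewrite leq_mul2r p07 orbT.
  by apply: (@twin_repeats_double d _ _ _ b 22 _ T mw); nlia.
have sd' : (p0, p1) = (5, 7) \/ (p0, p1) = (7, 5).
  have [e1 e7] : t 1 = true /\ t 7 = true by split; vm_compute.
  move: sd ntau; rewrite !inE => /or4P[|||/orP[]] /eqP[-> ->]; auto;
    by rewrite ?e1 ?e7.
have T : twin w (1 * 2 ^ d + (16 * 0 + p0)).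
  apply: (seed_twin we sd lt0 lt1 (or_introl erefl)).
  rewrite (_ : t p0 (+) t p1 = true); first by vm_compute.
  by move: ntau; case: (_ (+) _).
have shift v : v < 2 ^ d -> t (4 * 2 ^ d + v) = ~~ t v.
  by move=> vd; rewrite -(@tm_add_pow2 d.+2) ?expnS ?mulnA //; nlia.
(* [m = 2 * 2 ^ d + c] with [c] equal to 3, 5, -5, -3 in this order *)
case: sd' => -[e0 e1]; subst p0 p1; case: b mw => mw.
- apply: (@twin_repeats_single d _ _ _ true (2 ^ d + 4) k T mw); last by nlia.
    have -> : m = 2 * 2 ^ d + 3 by nlia.
    rewrite mul1n; clear; nia.
  have -> : m = 2 * 2 ^ d + 3 by nlia.
  rewrite mul1n; move: D64; clear; nia.
- exists 3, (3 + 2 * 2 ^ d); split; try nlia.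
  have em : m = 2 * 2 ^ d + 5 by nlia.
  apply: (@letters_to_blocks d m 3 2 6 15); first by nlia.
  rewrite em => u ur; have u3 : u < 3.
    by rewrite -(ltn_pmul2r (expn_gt0 2 d)); nlia.
  have -> : 6 + u + 2 * (2 * 2 ^ d + 5) = 4 * 2 ^ d + (16 + u) by nlia.
  rewrite shift; last by nlia.
  by case: u u3 {ur} => [|[|[|u]]] // _; vm_compute.
- exists 9, (9 + 2 * 2 ^ d); split; try nlia.
  have em : m + 5 = 2 * 2 ^ d by nlia.
  apply: (@letters_to_blocks d m 9 2 17 (2 ^ d - 45)); first by nlia.
  move=> u ur; have u3 : u < 3.
    by rewrite -(ltn_pmul2r (expn_gt0 2 d)); nlia.
  have -> : 17 + u + 2 * m = 4 * 2 ^ d + (7 + u) by nlia.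
  rewrite shift; last by nlia.
  by case: u u3 {ur} => [|[|[|u]]] // _; vm_compute.
- apply: (@twin_repeats_single d _ _ _ false (2 ^ d + 9) k T mw); last by nlia.
    have em : m + 3 = 2 * 2 ^ d by nlia.
    rewrite mul1n; move: em D64; clear; nia.
  have em : m + 3 = 2 * 2 ^ d by nlia.
  rewrite mul1n; move: em D64; clear; nia.
Qed.

Lemma decomposition_bounds m Z h p0 p1 b : decomposition m Z h p0 p1 b ->
  m <= Z * 2 ^ h.+1 + 13 /\ Z * 2 ^ h.+1 <= m + 13.
Proof.
move=> [_ sd _ [w [mw we]]].
have pc : p0 <= p1 + 6 /\ p1 <= p0 + 6.
  by move: sd; rewrite !inE => /or4P[|||/orP[]] /eqP[-> ->].
by rewrite expnS; move: mw we pc; clear; lia.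
Qed.

(** Unless [m] is close to [2 * 2 ^ d], the odd number [Z] is at least 3 and the
    power [2 ^ h.+1] is at most about [m / 3], so that [repeats_double]
    suffices. *)
Lemma repeats_by_four d m : odd m -> 64 <= 2 ^ d -> 3 * 2 ^ d < 2 * m ->
  m < 3 * 2 ^ d -> repeats m (4 * 2 ^ d).
Proof.
move=> om D64 lo hi.
have [Z [h [p0 [p1 [b dec]]]]] := odd_decomposition om (ltac:(lia) : 24 < m).
have [oZ _ _ _] := dec; have [lb ub] := decomposition_bounds dec.
have [Z1|Z1] := eqVneq Z 1.
  by subst Z; apply: (repeats_near_pow2 dec D64 lo hi); lia.
apply: (@repeats_double d m Z h p0 p1 b (2 * 2 ^ d)) => //; try lia.
have : 3 * 2 ^ h.+1 <= Z * 2 ^ h.+1 by rewrite leq_mul2r; lia.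
move=> ZH; have : 4 * 2 ^ h.+1 + 33 <= 2 * m by lia.
by move=> /(leq_mul (leqnn (2 ^ d))); lia.
Qed.

(** Either [repeats_single] applies, or [H = 2 ^ h.+1] is smaller than
    [1600 * 4 ^ e], that is, [H] is at most of order [(2 ^ d) ^ (2 / 3)]. *)
Lemma repeats_by_two d m : odd m -> 64 <= 2 ^ d -> 3 * 2 ^ d < 2 * m ->
  m + 13 < 3 * 2 ^ d ->
  exists H, H * H * H <= 1600 * (2 ^ d * 2 ^ d) /\ repeats m (2 * 2 ^ d + 3 * H + 22).
Proof.
move=> om D64 lo hi.
have [Z [h [p0 [p1 [b dec]]]]] := odd_decomposition om (ltac:(lia) : 24 < m).
have [oZ _ _ _] := dec; have [lb ub] := decomposition_bounds dec.
have [Z1|Z1] := eqVneq Z 1.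
  exists 0; split=> //; subst Z; apply: (repeats_near_pow2 dec D64 lo _); lia.
have Z3 : 3 * 2 ^ h.+1 <= Z * 2 ^ h.+1 by rewrite leq_mul2r; lia.
have hd : h.+1 <= d.
  by rewrite -ltnS -(@ltn_exp2l 2) // [2 ^ d.+1]expnS; lia.
pose e := d - h.+1.
have De : 2 ^ d = 2 ^ e * 2 ^ h.+1 by rewrite -expnD subnK.
have [big|small] := leqP (1600 * (2 ^ e * 2 ^ e)) (2 ^ h.+1).
  exists 0; split=> //; apply: (repeats_single dec _ _ big).
  - by lia.
  - by rewrite -(@ltn_pmul2r (2 ^ h.+1)) ?expn_gt0 // -mulnA -De; lia.
  - by rewrite -De; lia.
exists (2 ^ h.+1); split.
  rewrite De; have := leq_mul (leqnn (2 ^ h.+1 * 2 ^ h.+1)) (ltnW small).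
  by clear; lia.
by apply: (@repeats_double d m Z h p0 p1 b (3 * 2 ^ h.+1 + 22)) => //; clear -lo hi; nia.
Qed.

(** The constant is [1600 * 6 ^ 3], from [6 * N * H <= 2 ^ d]. *)
Lemma repeats_by_two_eps N d m k : 0 < N -> odd m -> 600 * 576 * (N * N * N) <= 2 ^ d ->
  3 * 2 ^ d < 2 * m -> m + 13 < 3 * 2 ^ d -> (2 * N + 1) * 2 ^ d <= N * k ->
  repeats m k.
Proof.
move=> N0 om DN lo hi Nk.
have N3 : N <= N * N * N by rewrite -{1}[N]mul1n leq_mul2r muln_gt0 N0 orbT.
have D64 : 64 <= 2 ^ d by clear -N0 N3 DN; lia.
have [H [H3]] := repeats_by_two om D64 lo hi.
apply: repeats_mono; set D := 2 ^ d in DN Nk H3 *.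
have HN : 6 * N * H <= D.
  rewrite leqNgt; apply/negP => lt.
  have D0 : 0 < D by lia.
  have l2 : D * D < 6 * N * H * (6 * N * H) by rewrite ltn_mul.
  have l3 : D * D * D < 6 * N * H * (6 * N * H) * (6 * N * H) by rewrite ltn_mul.
  have l4 : 216 * (N * N * N) * (H * H * H) <= 216 * (N * N * N) * (1600 * (D * D)).
    by rewrite leq_mul2l H3 orbT.
  have l5 : 600 * 576 * (N * N * N) * (D * D) <= D * (D * D) by rewrite leq_mul2r DN orbT.
  by move: l3 l4 l5; clear; lia.
rewrite -(leq_pmul2l N0); apply: leq_trans Nk.
by rewrite !mulnDr; lia.
Qed.

(** * Lengths without early repetitions *)

Lemma tm_top3 n v : v < 2 * 2 ^ n -> t (v + 3 * 2 ^ n) = t v.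
Proof.
move=> v2; have [t3 t4] : t 3 = false /\ t 4 = true by split; vm_compute.
have [lt|ge] := ltnP v (2 ^ n); first by rewrite addnC tm_block // t3.
have -> : v + 3 * 2 ^ n = 4 * 2 ^ n + (v - 2 ^ n) by lia.
rewrite tm_block; last by lia.
by rewrite t4 -{2}(subnKC ge) tm_add_pow2 //; lia.
Qed.

(** Two letters suffice: at an even position [2 v] the letter is [t v], and at
    distance [m] it is [~~ t (v + 3 * 2 ^ n.-1)], which is [~~ t v] by [tm_top3]
    as long as [v < 2 ^ n]. *)
Lemma no_repeats_3pow n k : 0 < n -> 3 * k + 6 <= 10 * 2 ^ n -> ~ repeats (3 * 2 ^ n + 1) k.
Proof.
case: n => // n _; set m := 3 * _ + 1; rewrite expnS => hk [i [j [ij jk E]]].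
have mE : m = 6 * 2 ^ n + 1 by rewrite /m expnS; lia.
have D0 : 0 < 2 ^ n by rewrite expn_gt0.
have DE : 2 ^ n.+2 = 4 * 2 ^ n by rewrite !expnS mulnA.
have [s s0 js] := @equal_blocks_step n.+2 m i j ltac:(lia) ltac:(lia) ij E.
have s1 : s = 1.
  apply/eqP; rewrite eqn_leq s0 andbT -ltnS -(ltn_pmul2r D0).
  by move: js; rewrite DE; lia.
subst s j; have im := divn_eq (i * m) (2 ^ n.+2).
have rD := ltn_pmod (i * m) (expn_gt0 2 n.+2 : 0 < 2 ^ n.+2).
set q := _ %/ _ in im; set r := _ %% _ in im rD.
have L u : u < 2 -> t (q + u) = t (q + u + 1 * m).
  move=> u2; apply: (blocks_to_letters E im rD).
  by move: u2; rewrite mE DE; case: u => [|[|]]; lia.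
have qb : q + 3 < 4 * 2 ^ n.
  rewrite -(ltn_pmul2r (_ : 0 < 4 * 2 ^ n)); last by lia.
  have : 3 * i + 9 <= 8 * 2 ^ n by move: jk; rewrite DE; lia.
  move=> /(leq_mul (leqnn (2 * 2 ^ n))); move: im; rewrite mE DE; lia.
have key v : v < 2 * 2 ^ n -> t (2 * v) <> t (2 * v + 1 * m).
  move=> v2; have -> : 2 * v + 1 * m = (2 * (v + 3 * 2 ^ n)).+1 by rewrite mE; lia.
  by rewrite tm2 tm2S tm_top3 //; case: (t v).
have := L (odd q); have -> : q + odd q = 2 * (q.+1)./2 by lia.
by move=> /(_ ltac:(case: (odd q))) /key; apply; lia.
Qed.

(** Converse of [twin_three]: a repetition of three letters at an odd distance
    forces a twin. *)
Lemma three_twin q p y (b : bool) m : q = 2 * p + b -> m = 2 * y + 1 ->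
  (forall u, u < 3 -> t (q + u) = t (q + u + 1 * m)) -> twin (y + b) p.
Proof.
move=> -> -> L; move: (L 0 isT) (L 1 isT) (L 2 isT); case: b {L}.
  have -> : 2 * p + true + 0 = (2 * p).+1 by lia.
  have -> : 2 * p + true + 1 = 2 * p.+1 by lia.
  have -> : 2 * p + true + 2 = (2 * p.+1).+1 by lia.
  have -> : (2 * p).+1 + 1 * (2 * y + 1) = 2 * (p + (y + 1)) by lia.
  have -> : 2 * p.+1 + 1 * (2 * y + 1) = (2 * (p + (y + 1))).+1 by lia.
  have -> : (2 * p.+1).+1 + 1 * (2 * y + 1) = 2 * (p + (y + 1)).+1 by lia.
  rewrite !tm2S !tm2 /twin.
  by case: (t p); case: (t p.+1); case: (t _); case: (t _) => //= ? ? ?.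
have -> : 2 * p + false + 0 = 2 * p by lia.
have -> : 2 * p + false + 1 = (2 * p).+1 by lia.
have -> : 2 * p + false + 2 = 2 * p.+1 by lia.
have -> : 2 * p + 1 * (2 * y + 1) = (2 * (p + (y + 0))).+1 by lia.
have -> : (2 * p).+1 + 1 * (2 * y + 1) = 2 * (p + (y + 0)).+1 by lia.
have -> : 2 * p.+1 + 1 * (2 * y + 1) = (2 * (p + (y + 0)).+1).+1 by lia.
rewrite !tm2S !tm2 /twin.
by case: (t p); case: (t p.+1); case: (t _); case: (t _) => //= ? ? ?.
Qed.

Lemma twin_odd w p : twin w p -> odd p /\ ~~ odd w.
Proof. by move=> [/tm_eqS_odd op /tm_eqS_odd]; rewrite oddD op; case: (odd w). Qed.

(** A block sees three letters, so a repetition yields a twin at [p], with [p]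
    odd.  Its distance is [2 ^ n + 2], because the other candidate is odd.  Below
    [2 ^ n] the twin means that [t p], [t p.+1] and [t p.+2] are equal; the block
    [i = 2 ^ n] remains and is checked directly. *)
Lemma no_repeats_pow_plus3 n k : 64 <= 2 ^ n -> k <= 2 * 2 ^ n + 1 ->
  ~ repeats (2 * 2 ^ n + 3) k.
Proof.
move=> D64 hk [i [j [ij jk E]]]; set m := 2 * 2 ^ n + 3 in E.
have eD : ~~ odd (2 ^ n) by rewrite oddX; case: (n) D64.
have [s s0 js] := @equal_blocks_step n m i j ltac:(lia) ltac:(lia) ij E.
have s2 : s <= 2.
  by rewrite -ltnS -(ltn_pmul2r (expn_gt0 2 n : 0 < 2 ^ n)); lia.
subst j; have im := divn_eq (i * m) (2 ^ n).
have rD := ltn_pmod (i * m) (expn_gt0 2 n : 0 < 2 ^ n).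
set q := _ %/ _ in im; set r := _ %% _ in im rD.
have L u : u < 3 -> t (q + u) = t (q + u + s * m).
  move=> u2; apply: (blocks_to_letters E im rD).
  by move: u2; rewrite /m; case: u => [|[|[|]]]; lia.
have shift v : v < 2 * 2 ^ n -> t (2 * 2 ^ n + v) = ~~ t v.
  by rewrite -expnS; apply: tm_add_pow2.
have shift1 v : v < 2 ^ n -> t (2 ^ n + v) = ~~ t v by apply: tm_add_pow2.
have [s2'|s1] := eqVneq s 2.
  have i0 : i = 0 by lia.
  move: (L 0 isT); rewrite /q s2' i0 mul0n div0n addn0 add0n tm2 /m shift; last by nlia.
  by vm_compute.
have {s0 s2 s1} s1 : s = 1 by lia.
subst s; have me : m = 2 * (2 ^ n + 1) + 1 by rewrite /m; lia.
have T := three_twin (_ : q = 2 * q./2 + odd q) me L.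
have {}T := T ltac:(lia).
have [op ow] := twin_odd T.
have oq : odd q by clear -ow eD; lia.
rewrite oq in T; set p := q./2 in T op.
have qp : q = 2 * p + 1 by rewrite /p; clear -oq; lia.
have qi : q * 2 ^ n <= 2 * i * 2 ^ n + 3 * i /\ 2 * i * 2 ^ n + 3 * i < q * 2 ^ n + 2 ^ n.
  by move: im rD; rewrite /m; clear; lia.
have qi1 : q = 2 * i + 1 \/ q = 2 * i + 3.
  have : 2 * i <= q by rewrite -ltnS -(ltn_pmul2r (expn_gt0 2 n : 0 < 2 ^ n)); lia.
  have : q < 2 * i + 4 by rewrite -(ltn_pmul2r (expn_gt0 2 n : 0 < 2 ^ n)); lia.
  by clear -qp; lia.
have i_lt : i <= 2 ^ n by lia.
have [pD|pD] := ltnP (p + 3) (2 ^ n).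
  case: T => e1 + ne.
  have -> : p + (2 ^ n + 1 + true) = 2 ^ n + p.+2 by lia.
  move=> e2; have := tm_cube e1; move: ne.
  have -> : p + (2 ^ n + 1 + true) = 2 ^ n + p.+2 by lia.
  by rewrite shift1 ?ltnS; [case: (t p); case: (t _)|lia].
have [iD pe] : i = 2 ^ n /\ p = 2 ^ n + 1.
  by case: qi1 => q1; move: qi; rewrite q1 !mulnDl; clear -pD qp q1 D64 i_lt; lia.
case: T => _ + _.
have -> : p + (2 ^ n + 1 + true) = 2 * 2 ^ n + 3 by lia.
rewrite -addnS !shift; try lia.
by vm_compute.
Qed.

Lemma tm_complement d v : v < 2 ^ d -> t (2 ^ d - 1 - v) = odd d (+) t v.
Proof.
elim: d v => [|d IH] v; first by rewrite expn0 ltnS leqn0 => /eqP ->.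
rewrite expnS mul2n -addnn => vd.
have [lt|ge] := ltnP v (2 ^ d).
  have -> : 2 ^ d + 2 ^ d - 1 - v = 2 ^ d + (2 ^ d - 1 - v) by lia.
  by rewrite tm_add_pow2 ?IH //=; [case: (odd d); case: (t v)|lia].
rewrite -{2}(subnKC ge) tm_add_pow2; last by lia.
have -> : 2 ^ d + 2 ^ d - 1 - v = 2 ^ d - 1 - (v - 2 ^ d) by lia.
by rewrite IH /=; [case: (odd d); case: (t _)|lia].
Qed.

(** The same method, with [t (p - 2)] in place of [t p.+2].  As [m < 2 * 2 ^ d],
    there are also blocks that see two letters only, namely those with
    [r <= 3]; then [3 * i + r] is a multiple of [2 ^ d], which leaves five values
    of [i].  The parity of [d] enters there, and through [tm_complement]. *)
Lemma no_repeats_pow_minus3 d : odd d -> 64 <= 2 ^ d ->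
  ~ repeats (2 * 2 ^ d - 3) (2 * 2 ^ d + 6).
Proof.
move=> od D64 [i [j [ij jk E]]]; set m := _ - 3 in E.
have D0 : 0 < 2 ^ d by lia.
have D4 : exists D', 2 ^ d = 8 * D'.
  have : 2 ^ 3 %| 2 ^ d.
    by apply: dvdn_exp2l; rewrite ltnNge -ltnS -(@ltn_exp2l 2) // -leqNgt; lia.
  by case/dvdnP => D' ->; exists D'; lia.
have D3 : exists D', 2 ^ d = 3 * D' + 2.
  have := odd_double_half d; rewrite od => <-; rewrite add1n expnS -mul2n expnM.
  have : (2 ^ 2) ^ d./2 = 1 %[mod 3] by rewrite -modnXm exp1n.
  have := divn_eq ((2 ^ 2) ^ d./2) 3 => + e; rewrite e => ->.
  by exists (2 * ((2 ^ 2) ^ d./2 %/ 3)); rewrite modn_small; lia.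
case: D4 D3 => D8 eD8 [D3 eD3].
have me : m + 3 = 2 * 2 ^ d by rewrite /m; lia.
have [s s0 js] := @equal_blocks_step d m i j ltac:(lia) ltac:(lia) ij E.
have s2 : s <= 2.
  by rewrite -ltnS -(ltn_pmul2r D0); lia.
subst j; have im := divn_eq (i * m) (2 ^ d).
have rD := ltn_pmod (i * m) D0.
set q := _ %/ _ in im; set r := _ %% _ in im rD.
have L u : u * 2 ^ d < r + m -> t (q + u) = t (q + u + s * m).
  exact: (blocks_to_letters E im rD).
have L0 : t q = t (q + s * m) by have := L 0; rewrite !addn0; apply; lia.
have L1 : t (q + 1) = t (q + 1 + s * m) by apply: L; lia.
have c4 v : v < 4 * 2 ^ d -> t (4 * 2 ^ d - 1 - v) = ~~ t v.
  by rewrite -[4]/(2 * 2) -mulnA -!expnS => vd; rewrite tm_complement //= od.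
have c2 v : v < 2 * 2 ^ d -> t (2 * 2 ^ d - 1 - v) = t v.
  by rewrite -!expnS => vd; rewrite tm_complement //= od.
have c1 v : v < 2 ^ d -> t (2 ^ d - 1 - v) = ~~ t v.
  by move=> vd; rewrite tm_complement //= od.
have a4 v : v < 4 * 2 ^ d -> t (4 * 2 ^ d + v) = ~~ t v.
  by rewrite -[4]/(2 * 2) -mulnA -!expnS; apply: tm_add_pow2.
have a2 v : v < 2 * 2 ^ d -> t (2 * 2 ^ d + v) = ~~ t v.
  by rewrite -expnS; apply: tm_add_pow2.
have a1 v : v < 2 ^ d -> t (2 ^ d + v) = ~~ t v by apply: tm_add_pow2.
(* [i * m = 2 * i * 2 ^ d - 3 * i] gives [r] and [q] in terms of [3 * i]. *)
have [e qe re] : exists2 e, q + e = 2 * i & 3 * i + r = e * 2 ^ d.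
  have im3 : i * m + 3 * i = 2 * i * 2 ^ d.
    by rewrite -mulnA [2 * _]mulnC -mulnA [_ * 2]mulnC -me; lia.
  have le : q <= 2 * i by rewrite -(leq_pmul2r D0); lia.
  exists (2 * i - q); first by lia.
  by rewrite mulnBl; lia.
have tt : [/\ t 0 = false, t 1 = true, t 2 = true, t 3 = false & t 4 = true] /\
   [/\ t 5 = false, t 7 = true & t 9 = false] by split; split; vm_compute.
case: tt => -[t0 t1 t2 t3 t4] [t5 t7 t9].
have [s2'|s1] := eqVneq s 2.
  have i6 : i < 6 by nlia.
  subst s; have : e = 0 /\ i = 0 \/ e = 1 /\ 0 < i.
    have : e < 2 by rewrite -(ltn_pmul2r D0); nlia.
    by case: e qe re => [|[|e]] // *; [left|right]; nlia.
  case=> [[e0 i0]|[e1 i0]].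
    have q0 : q = 0 by nlia.
    move: L0; rewrite q0 t0 (_ : 0 + 2 * m = 4 * 2 ^ d - 1 - 5); last by nlia.
    by rewrite c4 ?t5 //; nlia.
  have qi : q + 1 = 2 * i by nlia.
  have : q \in [:: 1; 3; 5; 7; 9] by rewrite !inE; nlia.
  rewrite !inE => /or4P[|||/orP[]] /eqP q1.
  - move: L0; rewrite (_ : q + _ = 4 * 2 ^ d - 1 - 4); last by nlia.
    rewrite q1.
    by rewrite c4 ?t1 ?t4 //; nlia.
  - move: L1; rewrite (_ : q + 1 + _ = 4 * 2 ^ d - 1 - 1); last by nlia.
    rewrite q1.
    by rewrite c4 ?t1 ?t4 //; nlia.
  - move: L0; rewrite (_ : q + _ = 4 * 2 ^ d - 1 - 0); last by nlia.
    rewrite q1.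
    by rewrite c4 ?t0 ?t5 //; nlia.
  - move: L0; rewrite (_ : q + _ = 4 * 2 ^ d + 1); last by nlia.
    rewrite q1.
    by rewrite a4 ?t1 ?t7 //; nlia.
  - move: L0; rewrite (_ : q + _ = 4 * 2 ^ d + 3); last by nlia.
    rewrite q1.
    by rewrite a4 ?t3 ?t9 //; nlia.
have {s0 s2 s1} s1 : s = 1 by nlia.
subst s; have my : m = 2 * (2 ^ d - 2) + 1 by nlia.
have [r4|r3] := leqP 4 r.
  have T := three_twin (_ : q = 2 * q./2 + odd q) my.
  have {}T : twin (2 ^ d - 2 + odd q) q./2.
    apply: T; first by nlia.
    by move=> u u3; apply: L; case: u u3 => [|[|[|u]]] // _; nlia.
  have [op ow] := twin_odd T.
  have eq : odd q = false by nlia.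
  rewrite eq addn0 in T; set p := q./2 in T op.
  have pD : p <= 2 ^ d + 3.
    have : q < 2 * 2 ^ d + 8; last by rewrite /p; nlia.
    rewrite -(ltn_pmul2r D0).
    have : (i + 1) * m <= (2 ^ d + 6) * m by rewrite leq_mul2r; apply/orP; right; nlia.
    have : (2 ^ d + 6) * (m + 3) = (2 ^ d + 6) * (2 * 2 ^ d) by rewrite me.
    by move: im me; clear; nlia.
  case: T => e1 e2 ne.
  have [p1|p1] := eqVneq p 1.
    move: ne; rewrite p1 (_ : 1 + _ = 2 ^ d - 1 - 0); last by nlia.
    have : t (2 ^ d - 1 - 0) = t (2 ^ d + 0).
      move: e2; rewrite p1 => e2.
      by rewrite (_ : 2 ^ d - 1 - 0 = 1 + (2 ^ d - 2)) ?e2; [congr t|]; nlia.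
    by rewrite a1 // c1 // t0 t1.
  have [pl|pg] := leqP p (2 ^ d).
    have p2 : p = (p - 2).+2 by nlia.
    move: e2 ne; rewrite (_ : p + _ = 2 ^ d + (p - 2)); last by nlia.
    rewrite -addnS !a1; try nlia.
    move=> /negb_inj /tm_cube; rewrite -p2 => ->.
    by case: (t (p - 2)).
  have [pe|pe] : p = 2 ^ d + 1 \/ p = 2 ^ d + 3 by nlia.
    move: e2; rewrite (_ : p + _ = 2 * 2 ^ d - 1 - 0); last by nlia.
    rewrite (_ : (2 * 2 ^ d - 1 - 0).+1 = 2 * 2 ^ d + 0); last by nlia.
    by rewrite c2 ?a2 ?t0 //; nlia.
  move: e1; rewrite pe -addnS !a1; try nlia.
  by rewrite t3 t4.
have e4 : e < 4 by rewrite -(ltn_pmul2r D0); nlia.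
case: e e4 qe re => [|[|[|[|e]]]] // _ qe re.
- have i0 : i = 0 by nlia.
  have q0 : q = 0 by nlia.
  move: L0; rewrite q0 (_ : 0 + 1 * m = 2 * 2 ^ d - 1 - 2); last by nlia.
  by rewrite c2 ?t0 ?t2 //; nlia.
- (* [3 * i = 2 ^ d - 2], so that [i] is 2 modulo 4 and [t i <> t (i - 2)] *)
  have ie : 3 * i + 2 = 2 ^ d by nlia.
  have [k ik] : exists k, i = 2 * (2 * k).+1 by exists (i./2./2); nlia.
  move: L1; rewrite (_ : q + 1 = 2 * i); last by nlia.
  rewrite (_ : 2 * i + _ = (2 * (2 ^ d + 2 * (2 * k))).+1); last by nlia.
  rewrite ik tm2S !tm2 a1; last by nlia.
  by rewrite tm2S !tm2 negbK; case: (t k).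
- (* [3 * i = 2 ^ d.+1 - 1]: a letter would be doubled at the even position
     [2 ^ d + i - 3] *)
  have ie : 3 * i + 1 = 2 * 2 ^ d by nlia.
  move: L0 L1; rewrite (_ : q + 1 = (2 * (i - 1)).+1); last by nlia.
  rewrite (_ : q = 2 * (i - 1)); last by nlia.
  rewrite (_ : (2 * (i - 1)).+1 + _ = 2 * (2 ^ d + i - 3).+1); last by nlia.
  rewrite (_ : 2 * (i - 1) + _ = (2 * (2 ^ d + i - 3)).+1); last by nlia.
  rewrite !tm2S !tm2 => -> /esym; rewrite negbK => /esym/tm_eqS_odd; nlia.
- have : i = 2 ^ d \/ i = 2 ^ d - 1 by nlia.
  case=> ie.
    move: L1; rewrite (_ : q + 1 + _ = 4 * 2 ^ d - 1 - 4); last by nlia.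
    rewrite (_ : q + 1 = 2 * 2 ^ d - 1 - 1); last by nlia.
    by rewrite c2 ?c4 ?t1 ?t4 //; nlia.
  move: L0; rewrite (_ : q + _ = 4 * 2 ^ d - 1 - 7); last by nlia.
  rewrite (_ : q = 2 * 2 ^ d - 1 - 4); last by nlia.
  by rewrite c2 ?c4 ?t7 ?t4 //; nlia.
Qed.

(** * Long lengths with an early repetition *)

(** For such an [m] block [i] starts just after [(3 * i - 1) * 2 ^ d], and its
    end [(i + 1) * m] must not exceed [(3 * i + 2) * 2 ^ d] for it to see three
    letters only; this is the bound [m <= (3 - 1 / (i + 1)) * 2 ^ d].  The
    lengths [m = 8 * a + 4 - 3 * i] put a doubled letter at distance [m ./2] from
    [p]; it complements [t p] when [t a = t p], which holds for one of any three
    consecutive [a]. *)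
Lemma repeats_near_triple d i p : 3 * i = 2 * p + 1 -> t p = t p.+1 ->
  24 * (i * i.+1) <= 2 ^ d ->
  exists m, [/\ odd m, repeats m (2 ^ d + i + 1) & (3 * i + 2) * 2 ^ d <= i.+1 * (m + 24)].
Proof.
move=> ip tp hd; set D := 2 ^ d in hd *.
have D0 : 0 < D by rewrite expn_gt0.
pose n := ((3 * i + 2) * D) %/ i.+1.
have i0 : 0 < i by lia.
have nlo : n * i.+1 <= (3 * i + 2) * D by apply: leq_trunc_div.
have nhi : (3 * i + 2) * D < n.+1 * i.+1 by rewrite ltn_ceil.
have nbig : 3 * i + 20 <= n.
  rewrite -ltnS -(ltn_pmul2r (_ : 0 < i.+1)) //; apply: leq_ltn_trans nhi.
  have : 24 * (i * i.+1) * (3 * i + 2) <= D * (3 * i + 2) by rewrite leq_mul2r hd orbT.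
  by move: i0; clear; nia.
(* the largest admissible [a], less at most 2 *)
have [a ab ta] := tm_recur ((n + 3 * i - 4) %/ 8 - 2) (t p).
have ab' : 8 * a <= n + 3 * i - 4 /\ n + 3 * i - 4 < 8 * a + 24 by clear -ab nbig i0; lia.
exists (8 * a + 4 - 3 * i); set m := _ - _.
have mn : m <= n < m + 24 by rewrite /m; clear -ab' nbig i0; lia.
have me : m + 3 * i = 8 * a + 4 by rewrite /m; clear -ab' nbig i0; lia.
have up : i.+1 * m <= (3 * i + 2) * D.
  by apply: leq_trans nlo; rewrite mulnC leq_mul2r; apply/orP; right; lia.
have hi : (3 * i + 2) * D <= i.+1 * (m + 24).
  by apply: leq_trans (ltnW nhi) _; rewrite mulnC leq_mul2l; apply/orP; right; lia.
split=> //; first by clear -me ip; lia.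
have lo : (3 * i - 1) * D <= i * m.
  rewrite -(leq_pmul2l (_ : 0 < i.+1)) //.
  have := leq_mul (leqnn i) hi; rewrite mulnBl => h1.
  have h2 : i * ((3 * i + 2) * D) = 3 * (i * (i * D)) + 2 * (i * D) by lia.
  have h3 : i * (i.+1 * (m + 24)) = i.+1 * (i * m) + 24 * (i * i.+1) by lia.
  have h4 : i.+1 * (3 * i * D - 1 * D) = 3 * (i * (i * D)) + 2 * (i * D) - D.
    by rewrite mulnBr; clear; lia.
  by lia.
exists i, (i + 1 * 2 ^ d); split; try lia.
have qE : 3 * i - 1 = 2 * p by lia.
apply: (@letters_to_blocks d m i 1 (2 * p) (i * m - 2 * p * D)).
  by rewrite subnKC // -qE.
move=> u ur; have u3 : u < 3.
  rewrite -(ltn_pmul2r D0); apply: leq_trans ur _.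
  have : (3 * i + 2) * D = 2 * p * D + 3 * D by rewrite -mulnDl; congr (_ * _); lia.
  by move: up lo; rewrite qE mulSn; lia.
rewrite -[2 * p]addn0 -[2 * p + 0]/(2 * p + false).
apply: (@twin_three (4 * a + 1 - p)) u3; last by clear -me ip; lia.
have le : p <= 4 * a + 1 by clear -me ip ab' nbig i0; lia.
have [_ b1 b2 _] := tm4 a.
rewrite /twin subnKC // -addnS b1 b2 ta; split=> //.
Qed.

(** * Antipowers and repetitions *)

Definition block m i := mkseq (fun x => t (i * m + x)) m.

Lemma tm_prefix_blocks k m : tm_prefix (k * m) = flatten (mkseq (block m) k).
Proof.
elim: k => [|k IH]; first by rewrite mul0n.
rewrite mkseqS flatten_rcons -IH /tm_prefix /mkseq mulSn addnC iotaD map_cat add0n.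
by congr (_ ++ _); rewrite -[k * m in LHS]addn0 iotaDl -map_comp.
Qed.

Lemma block_eqP m i j : block m i = block m j <-> equal_blocks m i j.
Proof.
split=> [e x xm|e].
  by rewrite -(nth_mkseq false (fun x => t (i * m + x)) xm) [mkseq _ _]e nth_mkseq.
by apply/eq_in_map => x; rewrite mem_iota => /andP[_ xm]; apply: e.
Qed.

Lemma antipower_blocks k m : 0 < k ->
  antipower k (tm_prefix (k * m)) <-> uniq (mkseq (block m) k).
Proof.
move=> k0; split=> [[n [ws [sw wn uw e]]]|u].
  have shn (s : seq (seq bool)) l : {in s, forall u, size u = l} -> shape s = nseq (size s) l.
    move=> sl; apply/(@eq_from_nth _ 0); rewrite size_map ?size_nseq // => i si.
    by rewrite (nth_map [::]) // nth_nseq si sl // mem_nth.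
  have sh := shn _ _ wn; rewrite sw in sh.
  have nm : n = m.
    have := congr1 size e; rewrite size_mkseq size_flatten sh sumn_nseq mulnC.
    by move/eqP; rewrite eqn_pmul2r // => /eqP.
  subst n; suff -> : mkseq (block m) k = ws by [].
  rewrite -[ws]flattenK -e sh tm_prefix_blocks -[LHS]flattenK; congr reshape.
  rewrite (shn _ m) ?size_mkseq // => w /mapP[i _ ->].
  by rewrite size_mkseq.
exists m, (mkseq (block m) k); split=> //; first by rewrite size_mkseq.
  by move=> w /mapP[i _ ->]; rewrite size_mkseq.
exact: tm_prefix_blocks.
Qed.

Lemma AP_repeats k m : 0 < k -> AP k m <-> odd m /\ ~ repeats m k.
Proof.
move=> k0; rewrite /AP /= antipower_blocks //; split=> -[om H]; split=> //.
  move=> [i [j [ij jk /block_eqP e]]].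
  have := mkseq_uniqP _ _ H; move=> /(_ i j); rewrite !inE => /(_ (ltn_trans ij jk) jk e).
  by move=> eij; rewrite eij ltnn in ij.
apply/mkseq_uniqP => i j; rewrite !inE => ik jk /block_eqP e.
have [ij|ji|//] := ltngtP i j; first by case: H; exists i, j.
by case: H; exists j, i; split=> // x xm; rewrite e.
Qed.

Lemma coAP_repeats k m : 0 < k -> coAP k m <-> odd m /\ repeats m k.
Proof.
move=> k0; rewrite /coAP /= AP_repeats //; split=> -[om H]; split=> //.
  by apply: contrapT => nc; apply: H.
by move=> [_].
Qed.

Lemma dyadic_scale m : 1 < m -> exists2 d, 3 * 2 ^ d < 2 * m & m <= 3 * 2 ^ d.
Proof.
move=> m3; have l0 : 0 < (2 * m - 1) %/ 3 by lia.
exists (trunc_log 2 ((2 * m - 1) %/ 3)).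
  by have := @trunc_logP 2 _ isT l0; lia.
by have := @trunc_log_ltn 2 ((2 * m - 1) %/ 3) isT; rewrite expnS; lia.
Qed.

Lemma repeats_gt_scale d m k : odd m -> 3 * 2 ^ d < 2 * m -> repeats m k -> 2 ^ d < k.
Proof.
move=> om lo [i [j [ij jk /(equal_blocks_step om lo ij)[s s0 e]]]].
by have : 2 ^ d <= s * 2 ^ d by [rewrite leq_pmull]; lia.
Qed.

Lemma repeats_lt k m : 0 < k -> odd m -> repeats m k -> m < 3 * k.
Proof.
move=> k0 om c; have [m1|m1] := leqP m 1; first lia.
have [d lo hi] := dyadic_scale m1.
by have := repeats_gt_scale om lo c; lia.
Qed.

Lemma gammaP k : 0 < k -> [/\ odd (gamma k), ~ repeats (gamma k) k &
  forall m, odd m -> ~ repeats m k -> gamma k <= m].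
Proof.
move=> k0.
have ex : exists m, `[< AP k m >].
  exists (3 * k).*2.+1; apply/asboolP/AP_repeats => //; split; first by rewrite /= odd_double.
  by move=> /(repeats_lt k0); rewrite /= odd_double => /(_ isT); lia.
have [m /asboolP APm mmin] := ex_minnP ex.
have [/= /(AP_repeats _ k0)[og ng] lb] : (AP k `&` lbound (AP k))%classic (gamma k).
  by apply: (@xgetI _ _ _ m); split=> // n APn; apply: mmin; apply/asboolP.
by split=> // n on nn; apply: lb; apply/AP_repeats.
Qed.

Lemma Gamma_ub k m : 0 < k -> odd m -> repeats m k -> m <= Gamma k.
Proof.
move=> k0 om cm; have Pm : coAP k m by apply/coAP_repeats.
have ex : exists m, `[< coAP k m >] by exists m; apply/asboolP.
have ub n : `[< coAP k n >] -> n <= 3 * k.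
  by move=> /asboolP/(coAP_repeats _ k0)[on cn]; apply/ltnW/repeats_lt.
have [g /asboolP Pg gmax] := ex_maxnP ex ub.
have [/= _ ubG] : (coAP k `&` ubound (coAP k))%classic (Gamma k).
  by apply: (@xgetI _ _ _ g); split=> // n Pn; apply: gmax; apply/asboolP.
exact: ubG.
Qed.

Lemma Gamma_le k M : 0 < k -> (forall m, odd m -> repeats m k -> m <= M) -> Gamma k <= M.
Proof.
move=> k0 H; rewrite /Gamma; case: xgetP => // g _ [/= /(coAP_repeats _ k0)[og cg] _].
exact: H.
Qed.

(** A crude bound, for the finitely many lengths that are too short for the
    asymptotic estimates. *)
Lemma repeats_pigeonhole m : repeats m (2 ^ m).+1.
Proof.
apply: contrapT => nc.
pose f (i : 'I_(2 ^ m).+1) := [tuple t (i * m + x) | x < m].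
have : injective f.
  move=> i j fij; apply: val_inj; apply: contrapT => /eqP ne.
  have E (a b : 'I_(2 ^ m).+1) : f a = f b -> equal_blocks m a b.
    by move=> fab x xm; have := congr1 (fun w => tnth w (Ordinal xm)) fab; rewrite !tnth_mktuple.
  have := ltn_ord i; have := ltn_ord j; move: ne; rewrite neq_ltn => /orP[ij|ij] jm im; apply: nc.
    by exists i, j; split=> //; apply: E.
  by exists j, i; split=> //; apply: E.
move=> /leq_card; rewrite card_ord card_tuple card_bool.
by rewrite ltnn.
Qed.

Lemma repeats_bounded M : exists K, forall m k, m < M -> K <= k -> repeats m k.
Proof.
exists (2 ^ M).+1 => m k mM Kk; apply: repeats_mono (repeats_pigeonhole m).
by apply: leq_trans Kk; rewrite ltnS leq_exp2l // ltnW.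
Qed.

(** * Estimates of gamma and Gamma *)

Lemma odd_scale d m : odd m -> 64 <= 2 ^ d -> m <= 3 * 2 ^ d -> m < 3 * 2 ^ d.
Proof.
move=> om D64; rewrite leq_eqVlt => /orP[/eqP e|//].
by move: om; rewrite e oddM oddX; case: d D64 {e}.
Qed.

Lemma repeats_below_scale : exists K, forall d m, odd m -> K <= 2 ^ d ->
  2 * m < 3 * 2 ^ d -> repeats m (2 * 2 ^ d).
Proof.
have [K bK] := repeats_bounded 193; exists K => d m om Kd md.
have [small|big] := ltnP m 193; first by apply: bK => //; lia.
have [d' lo hi] := dyadic_scale (ltac:(lia) : 1 < m).
have D64 : 64 <= 2 ^ d' by lia.
apply: repeats_mono (repeats_by_four om D64 lo (odd_scale om D64 hi)).
have : d'.+1 <= d by rewrite -(@ltn_exp2l 2) //; lia.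
by rewrite -(@leq_exp2l 2) // expnS; lia.
Qed.

Lemma gamma_le_triple k : 0 < k -> gamma k <= 3 * k + 1.
Proof.
move=> k0; have [_ _ gmin] := gammaP k0.
have oo : odd (3 * k + ~~ odd (3 * k)) by rewrite oddD; case: (odd (3 * k)).
have : gamma k <= 3 * k + ~~ odd (3 * k).
  by apply: gmin => // /(repeats_lt k0 oo); lia.
by case: (odd _) => /=; lia.
Qed.

(** For [m = gamma k] at scale [D], either [k <= (2 + 1 / N) * D], while
    [D < 2 / 3 * m], or [m] is within 13 of [3 * D], while [k < 4 * D]. *)
Lemma gamma_ge N : 0 < N -> exists k0, forall k, k0 <= k ->
  3 * N * k <= 4 * N * gamma k + 7 * k.
Proof.
move=> N0; set D0 := 600 * 576 * (N * N * N) + 64.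
have [K bK] := repeats_bounded (3 * D0); exists (K + 52 * N + 2) => k kk.
have k0 : 0 < k by lia.
have g3 := gamma_le_triple k0.
have [og ng _] := gammaP k0; set m := gamma k in og ng g3 *.
have mD : 3 * D0 <= m.
  by rewrite leqNgt; apply/negP => lt; apply: ng; apply: bK => //; lia.
have D064 : 64 <= D0 by rewrite /D0 leq_addl.
have [d lo hi] := dyadic_scale (ltac:(lia) : 1 < m).
have DD : D0 <= 2 ^ d by lia.
have D64 : 64 <= 2 ^ d by lia.
have {}hi := odd_scale og D64 hi.
have [c|c] := ltnP (m + 13) (3 * 2 ^ d).
  have ND : N * k < (2 * N + 1) * 2 ^ d.
    rewrite ltnNge; apply/negP => h; apply: ng.
    by apply: repeats_by_two_eps c h => //; apply: leq_trans DD; rewrite leq_addr.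
  have : (2 * N + 1) * (3 * 2 ^ d) <= (2 * N + 1) * (2 * m) by rewrite leq_mul2l ltnW ?orbT.
  by move: ND g3 kk; clear; lia.
have k4 : k < 4 * 2 ^ d.
  rewrite ltnNge; apply/negP => h; apply: ng.
  exact: repeats_mono h (repeats_by_four og D64 lo hi).
have : N * (3 * k) <= N * (4 * m + 52) by rewrite leq_mul2l; apply/orP; right; lia.
by move: kk; clear; lia.
Qed.

Lemma gamma_often_small k0 : exists2 k, k0 <= k & 10 * gamma k <= 9 * k + 34.
Proof.
pose n := k0.+3; have n0 : k0.+3 < 2 ^ n by rewrite ltn_expl.
pose k := (10 * 2 ^ n - 6) %/ 3.
have kb : 3 * k + 6 <= 10 * 2 ^ n /\ 10 * 2 ^ n <= 3 * k + 8 by rewrite /k; lia.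
exists k; first by lia.
have [_ _ gmin] := @gammaP k ltac:(lia).
have : gamma k <= 3 * 2 ^ n + 1.
  by apply: gmin; [rewrite addn1 /= oddM oddX|apply: no_repeats_3pow; lia].
lia.
Qed.

Lemma dyadic_floor k : 0 < k -> exists2 d, 2 ^ d <= k & k < 2 * 2 ^ d.
Proof. by move=> /top_bit[d lo hi]; exists d => //; lia. Qed.

(** The lengths [2 * 2 ^ d + 3] and [3 * 2 ^ d.-1 + 1] respectively. *)
Lemma gamma_case d k : 64 <= 2 ^ d -> 0 < k ->
  [/\ k <= 2 * 2 ^ d + 1 -> gamma k <= 2 * 2 ^ d + 3 &
      3 * k + 6 <= 5 * 2 ^ d -> 2 * gamma k <= 3 * 2 ^ d + 2].
Proof.
move=> D64 k0; have [_ _ gmin] := gammaP k0; split=> hk.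
  by apply: gmin; [lia|apply: no_repeats_pow_plus3].
case: d D64 hk => [|d] // D64; rewrite expnS => hk.
have : gamma k <= 3 * 2 ^ d + 1; last by lia.
case: d D64 hk => [|d] // D64 hk.
by apply: gmin; [rewrite expnS; lia|apply: no_repeats_3pow; lia].
Qed.

Lemma gamma_le : exists k0, forall k, k0 <= k -> 10 * gamma k <= 15 * k + 54.
Proof.
exists 128 => k kk; have [d lo hi] := dyadic_floor (ltac:(lia) : 0 < k).
have [g1 g2] := @gamma_case d k ltac:(lia) ltac:(lia).
have [/g2|h] := leqP (3 * k + 6) (5 * 2 ^ d); first lia.
by have := g1 ltac:(lia); lia.
Qed.

(** Take [k] slightly larger than [2 * 2 ^ d].  All lengths below
    [3 * 2 ^ d - 13] have repetitions before [k]: those above [3 / 2 * 2 ^ d] by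
    [repeats_by_two_eps], the others by [repeats_by_four] at smaller scales. *)
Lemma gamma_often_large N k0 : 0 < N ->
  exists2 k, k0 <= k & 3 * N * k <= 2 * N * gamma k + 4 * k.
Proof.
move=> N0; have [K bK] := repeats_below_scale.
pose d := 600 * 576 * (N * N * N) + K + k0 + 42 * N + 64.
have dD : d < 2 ^ d by rewrite ltn_expl.
have dl : [/\ 600 * 576 * (N * N * N) <= d, K <= d, k0 <= d, 42 * N <= d & 64 <= d].
  by rewrite /d; clear; split; lia.
clearbody d; case: dl => dl1 dl2 dl3 dl4 dl5.
(* [k] is about [(2 + 1 / N) * 2 ^ d]. *)
pose k := 2 * 2 ^ d + (2 ^ d %/ N).+1.
have kb : (2 * N + 1) * 2 ^ d <= N * k /\ N * k <= (2 * N + 1) * 2 ^ d + N.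
  have := divn_eq (2 ^ d) N; have := ltn_pmod (2 ^ d) N0.
  by rewrite /k; clear; lia.
have k2 : 2 * 2 ^ d <= k by rewrite leq_addr.
clearbody k; exists k; first by lia.
have kp : 0 < k by lia.
have g3 := gamma_le_triple kp.
have [og ng _] := gammaP kp; set m := gamma k in og ng g3 *.
have [h|h] := ltnP (2 * m) (3 * 2 ^ d).
  by case: ng; apply: repeats_mono k2 (bK _ _ og _ h); lia.
have lo : 3 * 2 ^ d < 2 * m.
  rewrite ltn_neqAle h andbT; apply/eqP => e; move: og.
  have : odd m.*2 = odd (2 ^ d./2 * 0) by rewrite odd_double muln0.
  case: d e dl5 {dD dl1 dl2 dl3 dl4 k2 kb h bK} => [|[|d]] // e _ _.
  have -> : m = 2 * (3 * 2 ^ d) by move: e; rewrite !expnS; lia.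
  by rewrite oddM.
have [c|c] := ltnP (m + 13) (3 * 2 ^ d).
  by case: ng; apply: repeats_by_two_eps N0 og _ lo c _; lia.
have : N * (3 * k) <= (2 * N + 1) * (m + 13) + 3 * N.
  have : (2 * N + 1) * (3 * 2 ^ d) <= (2 * N + 1) * (m + 13) by rewrite leq_mul2l c orbT.
  by move: kb; clear; lia.
by move: g3 dl4 k2 dD N0; clear; lia.
Qed.

Lemma Gamma_le_triple k : 0 < k -> Gamma k <= 3 * k.
Proof. by move=> k0; apply: Gamma_le => // m om /(repeats_lt k0 om)/ltnW. Qed.

Lemma Gamma_often_small k0 : exists2 k, k0 <= k & 2 * Gamma k <= 3 * k.
Proof.
exists (2 ^ k0.+1); first by rewrite ltnW // ltnW // ltn_expl.
have -> : 3 * 2 ^ k0.+1 = 2 * (3 * 2 ^ k0) by rewrite expnS; lia.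
rewrite leq_mul2l /=; apply: Gamma_le; first by rewrite expn_gt0.
move=> m om c; have [m1|m1] := leqP m 1; first by have := expn_gt0 2 k0; lia.
have [d lo hi] := dyadic_scale m1.
have := repeats_gt_scale om lo c; rewrite ltn_exp2l // ltnS -(@leq_exp2l 2) //; lia.
Qed.

Lemma Gamma_ge_step d i p k : 3 * i = 2 * p + 1 -> thue_morse p = thue_morse p.+1 ->
  24 * (i * i.+1) <= 2 ^ d -> 2 ^ d + i + 1 <= k ->
  (3 * i + 2) * 2 ^ d <= i.+1 * (Gamma k + 24).
Proof.
move=> ip tp hd hk; have [m [om cm mb]] := repeats_near_triple ip tp hd.
apply: leq_trans mb _; rewrite leq_mul2l leq_add2r; apply/orP; right.
by apply: Gamma_ub => //; [lia|apply: repeats_mono cm].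
Qed.

(** [repeats_near_triple] with [i = 8 * N + 1], for which [p = 12 * N + 1] is
    congruent to 1 modulo 4 and hence carries a doubled letter. *)
Lemma Gamma_ge N : 0 < N -> exists C, forall d k, C <= 2 ^ d -> 2 ^ d + C <= k ->
  3 * N * 2 ^ d <= N * Gamma k + 2 ^ d.
Proof.
move=> N0; pose i := 8 * N + 1; exists (24 * (i * i.+1)) => d k Cd Ck.
have ii : i.+1 <= i * i.+1 by rewrite leq_pmull // /i; lia.
have := @Gamma_ge_step d i (12 * N + 1) k ltac:(rewrite /i; lia).
have -> : thue_morse (12 * N + 1) = thue_morse (12 * N + 1).+1.
  have -> : 12 * N + 1 = 4 * (3 * N) + 1 by lia.
  by rewrite -addnS; have [_ -> -> _] := tm4 (3 * N).
move=> /(_ erefl Cd ltac:(move: ii Ck; clear; lia)) h.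
rewrite -(@leq_pmul2l i.+1) //.
have h2 : N * ((3 * i + 2) * 2 ^ d) <= N * (i.+1 * (Gamma k + 24)) by rewrite leq_mul2l h orbT.
have h3 : N * (24 * (i * i.+1)) <= N * 2 ^ d by rewrite leq_mul2l Cd orbT.
have h4 : N * i.+1 <= N * (i * i.+1) by rewrite leq_mul2l ii orbT.
rewrite /i in h2 h3 h4 *; move: h2 h3 h4; clear; lia.
Qed.

(** Let [D = 2 ^ d <= k < 2 * D].  Up to lower order terms: for [k <= D + 1],
    [gamma k <= D] and [Gamma k >= 3 / 2 * D]; for [k] between [D + 2] and
    [5 / 3 * D], [gamma k <= 3 / 2 * D] and [Gamma k >= 5 / 2 * D]; beyond,
    [gamma k <= 2 * D] and [Gamma k >= 3 * D]. *)
Lemma diff_ge N : 0 < N -> exists k0, forall k, k0 <= k ->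
  N * k + 2 * N * gamma k <= 2 * N * Gamma k + 3 * k.
Proof.
move=> N0; have [C bC] := Gamma_ge N0; exists (20 * C + 100 * N + 256) => k kk.
have [d lo hi] := dyadic_floor (ltac:(lia) : 0 < k).
have D64 : 64 <= 2 ^ d by lia.
have [g1 g2] := @gamma_case d k D64 ltac:(lia).
have [h1|h1] := leqP k (2 ^ d + 1).
  case: d lo hi D64 h1 {g1 g2} => [|d] // lo hi D64 h1.
  rewrite expnS in lo hi D64 h1.
  have [g _] := @gamma_case d k ltac:(lia) ltac:(lia).
  have := leq_mul (leqnn (2 * N)) (g h1); have := leq_mul (leqnn N) h1.
  by have := bC d k ltac:(lia) ltac:(lia); move: kk h1 lo; clear; lia.
have [h2|h2] := leqP (3 * k + 6) (5 * 2 ^ d).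
  have := @Gamma_ge_step d 1 1 k erefl ltac:(vm_compute) ltac:(lia) ltac:(lia) => G.
  have : N * (k + 2 * gamma k) <= N * (2 * Gamma k + 50).
    by rewrite leq_mul2l; apply/orP; right; have := g2 h2; lia.
  by move: kk; clear; lia.
have := leq_mul (leqnn (2 * N)) (g1 ltac:(lia)).
have : N * k <= N * (2 * 2 ^ d) by rewrite leq_mul2l ltnW ?orbT.
by have := bC d k ltac:(lia) ltac:(lia); move: kk lo h2; clear; lia.
Qed.

(** [k = 2 ^ d.+1 + 6] is the threshold of [repeats_near_triple] with [i = 5] and
    [p = 7], and [2 ^ d.+1 - 3] still has no repetition. *)
Lemma diff_often_large k0 : exists2 k, k0 <= k & 11 * k + 6 * gamma k <= 6 * Gamma k + 192.
Proof.
pose d := (2 * (k0 + 10)).+1.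
have dD : d < 2 ^ d by rewrite ltn_expl.
have D1 : 2 ^ 10 <= 2 ^ d by rewrite leq_exp2l // /d; lia.
have D720 : 24 * (5 * 6) <= 2 ^ d.+1 by rewrite expnS; move: D1; rewrite (_ : 2 ^ 10 = 1024) //; lia.
have D64 : 64 <= 2 ^ d by move: D720; rewrite expnS; lia.
have od : odd d by rewrite /d /= oddM.
exists (2 * 2 ^ d + 6); first by have : k0 <= d by [rewrite /d; lia]; lia.
have := @Gamma_ge_step d.+1 5 7 (2 * 2 ^ d + 6) erefl ltac:(vm_compute) D720.
rewrite expnS => /(_ ltac:(lia)) G.
have [_ _ gmin] := @gammaP (2 * 2 ^ d + 6) ltac:(lia).
have : gamma (2 * 2 ^ d + 6) <= 2 * 2 ^ d - 3.
  by apply: gmin; [lia|apply: no_repeats_pow_minus3].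
lia.
Qed.

Import Order.TTheory GRing.Theory Num.Theory.
Local Open Scope ring_scope.

(** * Limits of ratios *)

Lemma limn_esup_le (R : realType) (u : nat -> R) (a : R) :
  (forall e, 0 < e -> exists k0, forall k, (k0 <= k)%N -> u k <= a + e) ->
  (limn_esup (fun k => (u k)%:E) <= a%:E)%E.
Proof.
move=> H; apply/lee_addgt0Pr => e e0; have [k0 uk] := H e e0.
rewrite limn_esup_lim; apply: lime_le; first exact: is_cvg_esups.
exists k0 => // n /= kn; apply: ge_ereal_sup => _ [p /= np <-].
by rewrite -EFinD lee_fin uk // (leq_trans kn).
Qed.

Lemma limn_esup_ge (R : realType) (u : nat -> R) (a : R) :
  (forall e, 0 < e -> forall k0, exists2 k, (k0 <= k)%N & a - e <= u k) ->
  (a%:E <= limn_esup (fun k => (u k)%:E))%E.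
Proof.
move=> H; apply/lee_addgt0Pr => e e0; rewrite -leeBlDr // -EFinB.
rewrite limn_esup_lim; apply: lime_ge; first exact: is_cvg_esups.
apply: nearW => n; have [k nk uk] := H e e0 n.
by apply: (@le_trans _ _ (u k)%:E); [rewrite lee_fin|apply: ereal_sup_ubound; exists k].
Qed.

Lemma limn_einf_ge (R : realType) (u : nat -> R) (a : R) :
  (forall e, 0 < e -> exists k0, forall k, (k0 <= k)%N -> a - e <= u k) ->
  (a%:E <= limn_einf (fun k => (u k)%:E))%E.
Proof.
move=> H; rewrite /limn_einf leeNr -EFinN.
apply: (@limn_esup_le _ (fun k => - u k)) => e /H[k0 uk].
by exists k0 => k /uk; lra.
Qed.

Lemma limn_einf_le (R : realType) (u : nat -> R) (a : R) :
  (forall e, 0 < e -> forall k0, exists2 k, (k0 <= k)%N & u k <= a + e) ->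
  (limn_einf (fun k => (u k)%:E) <= a%:E)%E.
Proof.
move=> H; rewrite /limn_einf leeNl -EFinN.
apply: (@limn_esup_ge _ (fun k => - u k)) => e e0 k0; have [k kk uk] := H e e0 k0.
by exists k => //; lra.
Qed.

Lemma nat_above (R : realType) (e c : R) : 0 < e -> exists2 N : nat, (0 < N)%N & c <= e * N%:R.
Proof.
move=> e0; exists (Num.truncn (c / e)).+1 => //.
by rewrite mulrC -ler_pdivrMr // ltW // truncnS_gt.
Qed.

Lemma ratio_ge (R : realType) (N k : nat) (a e x C : R) : (0 < N)%N -> (0 < k)%N ->
  C <= e * N%:R -> a * N%:R * k%:R <= N%:R * x + C * k%:R -> a - e <= x / k%:R.
Proof.
move=> N0 k0 eN h; have NR : 0 < N%:R :> R by rewrite ltr0n.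
have kR : 0 < k%:R :> R by rewrite ltr0n.
rewrite ler_pdivlMr // -(ler_pM2l NR); have := ler_wpM2r (ltW kR) eN; lra.
Qed.

Lemma ratio_le (R : realType) (N k : nat) (a e x C : R) : (0 < N)%N -> (0 < k)%N ->
  C <= e * N%:R -> N%:R * x <= a * N%:R * k%:R + C * k%:R -> x / k%:R <= a + e.
Proof.
move=> N0 k0 eN h; have NR : 0 < N%:R :> R by rewrite ltr0n.
have kR : 0 < k%:R :> R by rewrite ltr0n.
rewrite ler_pdivrMr // -(ler_pM2l NR); have := ler_wpM2r (ltW kR) eN; lra.
Qed.

Lemma ratio_ge1 (R : realType) (M k : nat) (a e x C : R) : (M < k)%N ->
  C <= e * M%:R -> 0 < e -> a * k%:R <= x + C -> a - e <= x / k%:R.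
Proof.
move=> Mk eM e0 h; have kR : 0 < k%:R :> R by rewrite ltr0n; lia.
have : M%:R <= k%:R :> R by rewrite ler_nat ltnW.
by move=> /(ler_wpM2l (ltW e0)); rewrite ler_pdivlMr //; lra.
Qed.

Lemma ratio_le1 (R : realType) (M k : nat) (a e x C : R) : (M < k)%N ->
  C <= e * M%:R -> 0 < e -> x <= a * k%:R + C -> x / k%:R <= a + e.
Proof.
move=> Mk eM e0 h; have kR : 0 < k%:R :> R by rewrite ltr0n; lia.
have : M%:R <= k%:R :> R by rewrite ler_nat ltnW.
by move=> /(ler_wpM2l (ltW e0)); rewrite ler_pdivrMr //; lra.
Qed.

Local Open Scope ereal_scope.

Ltac cast R h := move: h; rewrite -(ler_nat R) ?natrM ?natrD ?natrM => h.

Theorem theorem11 (R : realType) :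
  [/\ (3 / 4)%R%:E <= limn_einf (fun k : nat => ((gamma k)%:R / k%:R : R)%R%:E)
        <= (9 / 10)%R%:E,
      limn_esup (fun k : nat => ((gamma k)%:R / k%:R : R)%R%:E) = (3 / 2)%R%:E,
      (1 / 2)%R%:E
        <= limn_einf
             (fun k : nat => (((Gamma k)%:R - (gamma k)%:R) / k%:R : R)%R%:E)
        <= (3 / 4)%R%:E
    & (11 / 6)%R%:E
        <= limn_esup
             (fun k : nat => (((Gamma k)%:R - (gamma k)%:R) / k%:R : R)%R%:E)
        <= (9 / 4)%R%:E].
Proof.
split.
- apply/andP; split.
    apply: limn_einf_ge => e e0; have [N N0 eN] := nat_above 7 e0.
    have [K gK] := gamma_ge N0; exists K.+1 => k kK.
    have h := gK k (ltnW kK); cast R h.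
    by have kR := ler0n R k; apply: (ratio_ge N0 _ eN); [lia|lra].
  apply: limn_einf_le => e e0 k0; have [M M0 eM] := nat_above 34 e0.
  have [k kk h] := gamma_often_small (k0 + M.+1); exists k; first by lia.
  by cast R h; have kR := ler0n R k; apply: (ratio_le1 _ eM e0); [lia|lra].
- apply/eqP; rewrite eq_le; apply/andP; split.
    apply: limn_esup_le => e e0; have [M M0 eM] := nat_above 54 e0.
    have [K gK] := gamma_le; exists (K + M.+1)%N => k kK.
    have h := gK k ltac:(lia); cast R h.
    by have kR := ler0n R k; apply: (ratio_le1 _ eM e0); [lia|lra].
  apply: limn_esup_ge => e e0 k0; have [N N0 eN] := nat_above 4 e0.
  have [k kk h] := gamma_often_large k0.+1 N0; exists k; first by lia.
  by cast R h; have kR := ler0n R k; apply: (ratio_ge N0 _ eN); [lia|lra].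
- apply/andP; split.
    apply: limn_einf_ge => e e0; have [N N0 eN] := nat_above 3 e0.
    have [K dK] := diff_ge N0; exists K.+1 => k kK.
    have h := dK k (ltnW kK); cast R h.
    by have kR := ler0n R k; apply: (ratio_ge N0 _ eN); [lia|lra].
  apply: limn_einf_le => e e0 k0; have [N N0 eN] := nat_above 7 e0.
  have [K gK] := gamma_ge N0; have [k kk h] := Gamma_often_small (k0 + K.+1).
  exists k; first by lia.
  have h2 := gK k ltac:(lia); cast R h2.
  have {}h : (N * (2 * Gamma k) <= N * (3 * k))%N by rewrite leq_mul2l h orbT.
  by cast R h; have kR := ler0n R k; apply: (ratio_le N0 _ eN); [lia|lra].
- apply/andP; split.
    apply: limn_esup_ge => e e0 k0; have [M M0 eM] := nat_above 192 e0.
    have [k kk h] := diff_often_large (k0 + M.+1); exists k; first by lia.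
    by cast R h; have kR := ler0n R k; apply: (ratio_ge1 _ eM e0); [lia|lra].
  apply: limn_esup_le => e e0; have [N N0 eN] := nat_above 7 e0.
  have [K gK] := gamma_ge N0; exists K.+1 => k kK.
  have h2 := gK k (ltnW kK); cast R h2.
  have h : (N * Gamma k <= N * (3 * k))%N.
    by rewrite leq_mul2l Gamma_le_triple ?orbT //; lia.
  by cast R h; have kR := ler0n R k; apply: (ratio_le N0 _ eN); [lia|lra].
Qed.
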